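(* Let $M$ be a positive integer and let $q\in(1,q_{KL}]\cup\big((q_{KL},M+1]\setminus\bigcup(p_L,p_R]\big)$, the union running over all entropy plateaus $[p_L,p_R]$. Then for every $x\in\mathcal U_q$ and every $\delta>0$, \[\dim_H\big(\mathcal U_q\cap(x-\delta,x+\delta)\big)=\dim_H\mathcal U_q .\]
   Context: Fix a positive integer $M$; all sequences have digits in $\{0,1,\dots,M\}$. For $q>1$ put $\pi_q((x_i))=\sum_{i\ge1}x_iq^{-i}$. For $q\in(1,M+1]$, $\mathcal U_q$ is the set of $x\in[0,M/(q-1)]$ having exactly one sequence $(x_i)$ with $\pi_q((x_i))=x$. Let $\alpha(q)$ be the quasi-greedy $q$-expansion of $1$ (lexicographically largest sequence not ending in $0^\infty$ with $\pi_q=1$). Sequences are compared lexicographically; $\overline{(x_i)}=(M-x_1)(M-x_2)\dots$; $\sigma$ is the left shift. $\mathbf V_q$ is the set of $(x_i)$ with $\overline{\alpha(q)}\preccurlyeq\sigma^n((x_i))\preccurlyeq\alpha(q)$ for all $n\ge0$, and $H(q)=h_{top}(\mathbf V_q)=\lim_n\frac1n\log\#\{\text{words of length }n\text{ occurring in }\mathbf V_q\}$. Let $(\tau_i)_{i\ge0}$ be the Thue–Morse sequence ($\tau_0=0$, $\tau_{2^n}\dots\tau_{2^{n+1}-1}=(1-\tau_0)\dots(1-\tau_{2^n-1})$). $q_{KL}$ is the base with $\alpha(q_{KL})=\lambda_1\lambda_2\dots$, $\lambda_i=k+\tau_i-\tau_{i-1}$ if $M=2k$, $\lambda_i=k+\tau_i$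 if $M=2k+1$. $\mathcal B=\{q\in(1,M+1]:H(p)\ne H(q)\ \forall p\ne q\}$, $\overline{\mathcal B}$ its closure. An entropy plateau is $[p_L,p_R]$ where $(p_L,p_R)$ is a connected component of $(q_{KL},M+1]\setminus\overline{\mathcal B}$. *)

(* Defs.v *)
From HB Require Import structures.
From mathcomp Require Import all_boot all_order all_algebra.
From mathcomp Require Import all_classical all_reals all_analysis.
Set Implicit Arguments. Unset Strict Implicit. Unset Printing Implicit Defensive.
Import Order.TTheory GRing.Theory Num.Theory.
Import numFieldNormedType.Exports.
Local Open Scope classical_set_scope.
Local Open Scope ring_scope.

(* Sequences (x_i)_{i>=1} are encoded as x : nat -> nat with x 0 = x_1. *)
Definition digit_seq (M : nat) (x : nat -> nat) := forall i, (x i <= M)%N.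

Section Defs.
Variable R : realType.
Variable M : nat.

Definition is_expansion (q : R) (x : nat -> nat) (r : R) :=
  digit_seq M x /\
  (fun n => \sum_(0 <= i < n) (x i)%:R * q ^- i.+1) @ \oo --> r.

Definition Uq (q : R) : set R :=
  [set r | 0 <= r <= M%:R / (q - 1) /\
           exists x, is_expansion q x r /\ forall y, is_expansion q y r -> x =1 y].

Definition lex_lt (x y : nat -> nat) :=
  exists n, (forall i, (i < n)%N -> x i = y i) /\ (x n < y n)%N.
Definition lex_le (x y : nat -> nat) := x =1 y \/ lex_lt x y.

Definition not_ending_in_0 (x : nat -> nat) := forall n, exists m, (n <= m)%N /\ x m <> 0%N.

Definition is_alpha (q : R) (a : nat -> nat) :=
  is_expansion q a 1 /\ not_ending_in_0 a /\
  forall b, is_expansion q b 1 -> not_ending_in_0 b -> lex_le b a.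

Definition reflect_seq (x : nat -> nat) := fun i => (M - x i)%N.
Definition shift (n : nat) (x : nat -> nat) := fun i => x (n + i)%N.

Definition Vq (q : R) : set (nat -> nat) :=
  [set x | digit_seq M x /\ exists a, is_alpha q a /\
      forall n, lex_le (reflect_seq a) (shift n x) /\ lex_le (shift n x) a].

Definition nwords (q : R) (n : nat) : nat :=
  #|[set w : n.-tuple 'I_M.+1 |
     `[< exists x k, Vq q x /\ forall i : 'I_n, x (k + i)%N = nat_of_ord (tnth w i) >]]|.

Definition Hent (q : R) : R := limn (fun n : nat => ln (nwords q n)%:R / n%:R).

Definition Bset : set R :=
  [set q | 1 < q <= M.+1%:R /\
           forall p, 1 < p <= M.+1%:R -> p != q -> Hent p != Hent q].

Definition is_plateau (qKL pL pR : R) :=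
  pL < pR /\
  exists z, connected_component
              ([set q | qKL < q <= M.+1%:R] `\` closure Bset) z = `]pL, pR[%classic.
End Defs.

(* Thue-Morse: tau_0 = 0 and tau_{2^k + j} = 1 - tau_j for j < 2^k
   (fuel-based recursion; fuel n suffices) *)
Fixpoint tm_aux (fuel n : nat) : nat :=
  match fuel with
  | 0 => 0
  | f.+1 => if n == 0 then 0 else (1 - tm_aux f (n - 2 ^ trunc_log 2 n))%N
  end.
Definition tau (n : nat) : nat := tm_aux n n.

(* lambda_i (i >= 1), stored at index i-1 *)
Definition lamKL (M : nat) : nat -> nat := fun j =>
  if odd M then (M./2 + tau j.+1)%N else (M./2 + tau j.+1 - tau j)%N.

Section Hdim.
Variable R : realType.
Local Open Scope ereal_scope.

Definition diam (A : set R) : \bar R :=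
  ereal_sup ([set (`|x - y|)%:E | x in A & y in A] `|` [set 0]).

Definition hmeas_delta (s delta : R) (E : set R) : \bar R :=
  ereal_inf [set \sum_(0 <= i <oo) poweR (diam (U i)) s | U in
             [set U : nat -> set R | E `<=` \bigcup_i U i /\
                                     forall i, diam (U i) <= delta%:E]].

(* H^s(E) = lim_{delta -> 0+} H^s_delta(E) = sup_{delta > 0} H^s_delta(E) *)
Definition hmeas (s : R) (E : set R) : \bar R :=
  ereal_sup [set hmeas_delta s delta E | delta in [set d : R | (0 < d)%R]].

Definition dimH (E : set R) : \bar R :=
  ereal_inf [set s%:E | s in [set s : R | (0 <= s)%R /\ hmeas s E = 0]].
End Hdim.

(* Main.v *)
(* For s > 0 one shows that if U_q has s-dimensional Hausdorff measure 0 near one of its points, then it has measure 0 globally.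
   Up to countably many sequences, U_q is a countable union of affine copies of pi_q(V_q), so it is enough to treat pi_q(V_q).
   For q <= q_KL every sequence of V_q outside a countable set is, for each n, eventually made of Thue-Morse blocks of length 2^n with at most two choices per block, so all positive-dimensional measures vanish.
   For q > q_KL the plateau hypothesis makes q a left limit of B, hence H(p) < H(q) for p < q.
   Sequences avoiding a prefix of alpha(q) and its reflection lie in some V_p with p < q, so covering by cylinders gives them dimension at most H(p)/log q, whereas a Furstenberg-type covering argument (finite subcover, then iteration of the covering words, using that distinct sequences of V_q are separated when q < M+1) gives dim pi_q(V_q) >= H(q)/log q.
   Therefore the sequences of V_q that follow a long prefix of alpha(q) decide whether pi_q(V_q) is null, and these can be grafted after any prefix of a univoque sequence, that is, into any neighbourhood.
   At q = M+1 every sequence can be grafted. *)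

Require Import Defs.
From HB Require Import structures.
From mathcomp Require Import all_boot all_order all_algebra.
From mathcomp Require Import all_classical all_reals all_analysis.
From mathcomp Require Import zify ring lra.
Import Defs.
Set Implicit Arguments. Unset Strict Implicit. Unset Printing Implicit Defensive.
Import Order.TTheory GRing.Theory Num.Theory.
Import numFieldNormedType.Exports.
Local Open Scope classical_set_scope.
Local Open Scope ring_scope.

(** * Hausdorff null sets *)

(** No dimension is ever computed: [dimH] is compared through the exponents s > 0 at which a set is
    null. Entropy serves to produce one exponent t at which V_q is not null although its sequences
    avoiding a given prefix of alpha(q) are. If the sequences following that prefix are null at s,
    then V_q is null at max(s, t); this maximum cannot be t, so it is s. The obstacle in grafting is
    the lower bound. Where the kept prefix ends by imitating the reflection of alpha(q), the graft
    has to leave that imitation upwards, which requires every shift of the reflected alpha(q) to be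
    strictly below alpha(q). This comes from the same exponent t rather than from a combinatorial
    description of plateaus: if it failed, the sequences of V_q following alpha(q) for long enough
    would not exist or would all end in the reflection of alpha(q). They would be null at t, and V_q
    with them. *)

Section NullSets.
Variable R : realType.
Implicit Types (s t e : R) (E F : set R).

(** Vanishing s-dimensional measure, for s > 0, in real-number form: [c i] bounds the diameter of
    [U i], and no fineness of the cover is asked for, because a small total already forces every
    [c i] to be small. *)
Definition null s E := forall e, 0 < e -> exists (U : nat -> set R) (c : nat -> R),
  [/\ E `<=` \bigcup_i U i, forall i, 0 <= c i,
      forall i x y, U i x -> U i y -> `|x - y| <= c i &
      forall n, \sum_(i < n) c i `^ s <= e].

Lemma diam_ge0 E : (0 <= diam E)%E.
Proof. by apply: ereal_sup_ubound; right. Qed.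

Lemma hmeas_null s E : 0 < s -> hmeas s E = 0%E -> null s E.
Proof.
move=> s0 hE e e0.
have hd : (hmeas_delta s 1 E <= 0)%E.
  by rewrite -hE; apply: ereal_sup_ubound; exists 1; rewrite /=?ltr01.
have : (hmeas_delta s 1 E < e%:E)%E by apply: le_lt_trans hd _; rewrite lte_fin.
move=> /ereal_inf_lt [_ [U [EU dU] <-] sume].
exists U, (fun i => fine (diam (U i))).
have fU i : diam (U i) \is a fin_num.
  by rewrite ge0_fin_numE ?diam_ge0//; apply: le_lt_trans (dU i) _; rewrite ltry.
split => //.
- by move=> i; apply: fine_ge0; exact: diam_ge0.
- move=> i x y Ux Uy; rewrite -lee_fin fineK//; apply: ereal_sup_ubound; left.
  by exists x => //; exists y.
- move=> n; rewrite -lee_fin; apply: le_trans (ltW sume).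
  rewrite -sumEFin.
  rewrite (eq_bigr (fun i : 'I_n => poweR (diam (U i)) s)); last first.
    by move=> i _; rewrite -poweR_EFin fineK.
  rewrite -(big_mkord xpredT (fun i => poweR (diam (U i)) s)).
  by apply: nneseries_lim_ge => i _ _; exact: poweR_ge0.
Qed.

Lemma null_hmeas s E : 0 < s -> null s E -> hmeas s E = 0%E.
Proof.
move=> s0 nE; apply/eqP; rewrite eq_le; apply/andP; split; last first.
  apply: (@le_trans _ _ (hmeas_delta s 1 E)); last first.
    by apply: ereal_sup_ubound; exists 1; rewrite /= ?ltr01.
  apply: le_ereal_inf_tmp => _ [U _ <-].
  by apply: nneseries_ge0 => i _ _; exact: poweR_ge0.
apply: ge_ereal_sup => _ [d /= d0 <-].
apply/lee_addgt0Pr => e e0; rewrite add0e.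
have ds0 : 0 < d `^ s by apply: powR_gt0.
(* A total of at most d^s forces each [c i <= d], so the cover is admissible at scale [d]. *)
have m0 : 0 < Num.min e (d `^ s) by rewrite lt_min e0.
have [U [c [EU c0 cU sc]]] := nE _ m0.
have dUc i : (diam (U i) <= (c i)%:E)%E.
  apply: ge_ereal_sup => z [[x Ux [y Uy <-]]|->]; rewrite lee_fin//.
  exact: cU.
have cd i : c i <= d.
  rewrite leNgt; apply/negP => dc.
  have : d `^ s < c i `^ s by apply: gt0_ltr_powR => //; rewrite nnegrE ?(ltW d0).
  apply/negP; rewrite -leNgt.
  apply: (@le_trans _ _ (\sum_(j < i.+1) c j `^ s)).
    by rewrite big_ord_recr /= lerDr; apply: sumr_ge0 => j _; exact: powR_ge0.
  by apply: le_trans (sc _) _; rewrite ge_min lexx orbT.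
apply: (@le_trans _ _ (\sum_(0 <= i <oo) poweR (diam (U i)) s)%E).
  apply: ereal_inf_lbound; exists U => //; split => // i; apply: le_trans (dUc i) _.
  by rewrite lee_fin.
apply: lime_le; first by apply: is_cvg_nneseries => i _ _; exact: poweR_ge0.
apply: nearW => n.
apply: (@le_trans _ _ (\sum_(i < n) c i `^ s)%:E).
  rewrite big_mkord -sumEFin; apply: lee_sum => i _.
  rewrite -poweR_EFin; apply: gt0_ler_poweR => //; first exact: ltW.
  - by rewrite in_itv /= diam_ge0 leey.
  - by rewrite in_itv /= lee_fin c0 leey.
by rewrite lee_fin; apply: le_trans (sc _) _; rewrite ge_min lexx.
Qed.

(** Every term of a cover has power 0 equal to 1, even for an empty set, so the exponent 0 never
    enters the infimum defining [dimH]. *)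
Lemma hmeas0_neq0 E : hmeas 0 E <> 0%E.
Proof.
move=> h0.
have hd : (hmeas_delta 0 1 E <= 0)%E.
  by rewrite -h0; apply: ereal_sup_ubound; exists 1; rewrite /=?ltr01.
have : (hmeas_delta 0 1 E < 1%:E)%E by apply: le_lt_trans hd _; rewrite lte_fin.
move=> /ereal_inf_lt [_ [U _ <-]].
apply/negP; rewrite -leNgt.
have := @nneseries_lim_ge R (fun i => poweR (diam (U i)) 0) xpredT 0 1
  (fun n _ _ => poweR_ge0 _ _).
by rewrite big_nat1 poweRe0.
Qed.

Lemma null_sub s E F : E `<=` F -> null s F -> null s E.
Proof.
move=> EF nF e /nF[U [c [FU c0 cU sc]]]; exists U, c; split => //.
exact: subset_trans FU.
Qed.

Lemma sum_powR_le (s e : R) (c : nat -> R) : 0 < s -> (forall i, 0 <= c i) ->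
  (forall n, \sum_(i < n) c i `^ s <= e) -> forall i, c i `^ s <= e.
Proof.
move=> s0 c0 sc i; apply: le_trans (sc i.+1).
by rewrite big_ord_recr /= lerDr; apply: sumr_ge0 => j _; exact: powR_ge0.
Qed.

Lemma powR_le_inv (s a b : R) : 0 < s -> 0 <= a -> 0 <= b -> a `^ s <= b `^ s -> a <= b.
Proof.
move=> s0 a0 b0; apply: contraTT; rewrite -!ltNge => ba.
by apply: gt0_ltr_powR.
Qed.

(** A total of at most 1 makes every [c i] at most 1, and there a larger exponent gives a smaller
    power. *)
Lemma null_le s t E : 0 < s -> s <= t -> null s E -> null t E.
Proof.
move=> s0 st nE e e0.
have m0 : 0 < Num.min e 1 by rewrite lt_min e0 ltr01.
have [U [c [EU c0 cU sc]]] := nE _ m0.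
exists U, c; split => // n.
apply: (@le_trans _ _ (\sum_(i < n) c i `^ s)); last first.
  by apply: le_trans (sc n) _; rewrite ge_min lexx.
apply: ler_sum => i _.
have [->|ci0] := eqVneq (c i) 0.
  by rewrite !powR0// gt_eqF// (lt_le_trans s0).
apply: ger_powR => //; rewrite lt_neqAle eq_sym ci0 c0 /=.
apply: (@powR_le_inv s) => //; rewrite powR1.
by apply: le_trans (sum_powR_le s0 c0 sc i) _; rewrite ge_min lexx orbT.
Qed.

Lemma geo_half_sum (e : R) n : 0 <= e -> \sum_(i < n) e / 2 ^+ i.+1 <= e.
Proof.
move=> e0.
have -> : \sum_(i < n) e / 2 ^+ i.+1 = e - e / 2 ^+ n.
  elim: n => [|n IH]; first by rewrite big_ord0 expr0 divr1 subrr.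
  have p0 : (2 : R) ^+ n != 0 by rewrite expf_neq0.
  rewrite big_ord_recr /= IH exprS; field.
  by rewrite p0.
by rewrite gerBl divr_ge0// exprn_ge0.
Qed.

(** The first n codes decode to distinct pairs inside a finite square, and the rows of the square
    carry the geometric bounds. *)
Lemma sum_pickle_inv_le (f : nat * nat -> R) (e : R) : 0 <= e -> (forall p, 0 <= f p) ->
  (forall a n, \sum_(b < n) f (a, nat_of_ord b) <= e / 2 ^+ a.+1) ->
  forall n, \sum_(i < n) oapp f 0 (pickle_inv i) <= e.
Proof.
move=> e0 f0 fe n.
pose m := \max_(i < n) oapp (fun p : nat * nat => maxn p.1 p.2) 0%N (pickle_inv i).
pose g (p : 'I_m.+1 * 'I_m.+1) : nat * nat := (nat_of_ord p.1, nat_of_ord p.2).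
apply: (@le_trans _ _ (\sum_(a < m.+1) \sum_(b < m.+1) f (nat_of_ord a, nat_of_ord b))); last first.
  apply: (@le_trans _ _ (\sum_(a < m.+1) e / 2 ^+ a.+1)); last exact: geo_half_sum.
  by apply: ler_sum => a _; exact: fe.
rewrite pair_big /=.
apply: (@le_trans _ _ (\sum_(i < n) \sum_(p : 'I_m.+1 * 'I_m.+1)
     if pickle_inv i == Some (g p) then f (g p) else 0)).
  apply: ler_sum => i _.
  case E: (pickle_inv i) => [[a b]|] /=; last first.
    by apply: sumr_ge0 => p _ //; case: ifP.
  have hm : (maxn a b <= m)%N.
    by have := @leq_bigmax _ (fun i : 'I_n => oapp (fun p : nat * nat => maxn p.1 p.2) 0%N (pickle_inv i)) i; rewrite E.
  have ha : (a < m.+1)%N by rewrite ltnS (leq_trans _ hm)// leq_maxl.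
  have hb : (b < m.+1)%N by rewrite ltnS (leq_trans _ hm)// leq_maxr.
  rewrite (bigD1 (Ordinal ha, Ordinal hb)) //= /g /= eqxx lerDl.
  by apply: sumr_ge0 => p _ //; case: ifP.
rewrite exchange_big /=; apply: ler_sum => p _.
rewrite -big_mkcond /=.
have [k Pk|noP] := pickP (fun i : 'I_n => pickle_inv i == Some (g p)); last by rewrite big_pred0.
rewrite (big_pred1 k)//= => i; apply/idP/eqP => [/eqP Pi|->//].
apply/val_inj => /=.
have := @pickle_invK (nat * nat)%type i; rewrite Pi /= => <-.
by have := @pickle_invK (nat * nat)%type k; rewrite (eqP Pk) /= => <-.
Qed.

Lemma null_bigcup (I : countType) s (E : I -> set R) : 0 < s ->
  (forall i, null s (E i)) -> null s (\bigcup_i E i).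
Proof.
move=> s0 nE e e0.
pose G (a : nat) := if pickle_inv a is Some i then E i else set0.
have nG a : null s (G a).
  rewrite /G; case: pickle_inv => [i//|] e' e'0.
  exists (fun _ => set0), (fun _ => 0); split => //= n.
  by rewrite big1 ?ltW// => i _; rewrite powR0// gt_eqF.
have /choice[UC UCP] : forall a, exists UC : (nat -> set R) * (nat -> R),
  [/\ G a `<=` \bigcup_i UC.1 i, forall i, 0 <= UC.2 i,
      forall i x y, UC.1 i x -> UC.1 i y -> `|x - y| <= UC.2 i &
      forall n, \sum_(i < n) UC.2 i `^ s <= e / 2 ^+ a.+1].
  move=> a; have [|U [c H]] := nG a (e / 2 ^+ a.+1); last by exists (U, c).
  by rewrite divr_gt0// exprn_gt0.
exists (fun i => oapp (fun p : nat * nat => (UC p.1).1 p.2) set0 (pickle_inv i)).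
exists (fun i => oapp (fun p : nat * nat => (UC p.1).2 p.2) 0 (pickle_inv i)).
split.
- move=> x [i _ Ex].
  have Gx : G (pickle i) x by rewrite /G pickleK_inv.
  have [cov _ _ _] := UCP (pickle i).
  have [b _ Ub] := cov _ Gx.
  by exists (pickle (pickle i, b)) => //; rewrite pickleK_inv.
- by move=> i; case: pickle_inv => //= p; have [_ c0 _ _] := UCP p.1.
- by move=> i x y; case: pickle_inv => //= p; have [_ _ + _] := UCP p.1; apply.
- move=> n.
  pose f (p : nat * nat) := (UC p.1).2 p.2 `^ s.
  rewrite (eq_bigr (fun i : 'I_n => oapp f 0 (pickle_inv i))); last first.
    by move=> i _; case: pickle_inv => //=; rewrite powR0// gt_eqF.
  apply: sum_pickle_inv_le => //; first exact: ltW.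
  + by move=> p; exact: powR_ge0.
  + by move=> a m; have [_ _ _] := UCP a; apply.
Qed.

Lemma null_affine s (a b : R) E : 0 < s -> null s E -> null s [set a * x + b | x in E].
Proof.
move=> s0 nE e e0.
(* The factor |a| + 1 instead of |a| stays positive when a = 0. *)
have K0 : 0 < (`|a| + 1) `^ s by apply: powR_gt0; rewrite ltr_wpDl.
have [|U [c [EU c0 cU sc]]] := nE (e / (`|a| + 1) `^ s); first exact: divr_gt0.
exists (fun i => [set a * x + b | x in U i]), (fun i => (`|a| + 1) * c i); split.
- by move=> _ [x /EU[i _ Ui] <-]; exists i => //; exists x.
- by move=> i; rewrite mulr_ge0// addr_ge0.
- move=> i _ _ [x Ux <-] [y Uy <-].
  have -> : a * x + b - (a * y + b) = a * (x - y) by ring.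
  by rewrite normrM ler_pM// ?lerDl// cU.
- move=> n.
  rewrite (eq_bigr (fun i : 'I_n => (`|a| + 1) `^ s * c i `^ s)); last first.
    by move=> i _; rewrite powRM// addr_ge0.
  by rewrite -mulr_sumr mulrC -ler_pdivlMr// sc.
Qed.

Lemma null_fin_cover s E : 0 < s ->
  (forall e, 0 < e -> exists (n : nat) (U : nat -> set R) (d : R),
     [/\ E `<=` \bigcup_(i in [set i | (i < n)%N]) U i, 0 <= d,
         forall i x y, U i x -> U i y -> `|x - y| <= d & n%:R * d `^ s <= e]) ->
  null s E.
Proof.
move=> s0 H e /H[n [U [d [EU d0 dU nd]]]].
exists (fun i => if (i < n)%N then U i else set0), (fun i => if (i < n)%N then d else 0).
split.
- by move=> x /EU[i /= ilt Ui]; exists i => //; rewrite ilt.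
- by move=> i; case: ifP.
- by move=> i x y; case: ifP => // _; exact: dU.
- move=> m; apply: le_trans nd.
  rewrite (eq_bigr (fun i : 'I_m => if (i < n)%N then d `^ s else 0)); last first.
    by move=> i _; case: ifP => // _; rewrite powR0// gt_eqF.
  suff -> : \sum_(i < m) (if (i < n)%N then d `^ s else 0) = (minn m n)%:R * d `^ s.
    by rewrite ler_wpM2r ?powR_ge0// ler_nat geq_minr.
  elim: m => [|m IH]; first by rewrite big_ord0 min0n mul0r.
  rewrite big_ord_recr /= IH; case: ltnP => mn.
  + by rewrite (minn_idPl mn) -natr1 mulrDl mul1r.
  + by rewrite addr0 (minn_idPr (leqW mn)).
Qed.

Lemma null_point s x : 0 < s -> null s [set x].
Proof.
move=> s0; apply: null_fin_cover => // e e0.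
exists 1%N, (fun=> [set x]), 0; split => //.
- by move=> y ->; exists 0%N.
- by move=> _ y z -> ->; rewrite subrr normr0.
- by rewrite powR0 ?gt_eqF// mulr0 ltW.
Qed.

(* Strict positivity of the sizes lets every covering set be compared with a cylinder of finite length. *)
Lemma null_pos_cover s E e : 0 < s -> 0 < e -> null s E ->
  exists (U : nat -> set R) (c : nat -> R),
  [/\ E `<=` \bigcup_i U i, forall i, 0 < c i,
      forall i x y, U i x -> U i y -> `|x - y| <= c i &
      forall n, \sum_(i < n) c i `^ s <= e].
Proof.
move=> s0 e0 nE.
have e20 : 0 < e / 2 by rewrite divr_gt0.
have [U [c [EU c0 cU sc]]] := nE _ e20.
have w0 i : 0 < e / 2 / 2 ^+ i.+1 by rewrite divr_gt0// exprn_gt0.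
pose d i := (e / 2 / 2 ^+ i.+1) `^ s^-1.
have d0 i : 0 < d i by apply: powR_gt0.
exists U, (fun i => Num.max (c i) (d i)); split => //.
- by move=> i; rewrite lt_max d0 orbT.
- by move=> i x y Ux Uy; rewrite le_max cU.
- move=> n; rewrite [leRHS](splitr e).
  apply: le_trans (lerD (sc n) (geo_half_sum n (ltW e20))).
  rewrite -big_split /=; apply: ler_sum => i _.
  have ds : d i `^ s = e / 2 / 2 ^+ i.+1.
    by rewrite /d -powRrM mulVf ?gt_eqF// powRr1// ltW.
  have [cd|dc] := leP (c i) (d i); last by rewrite lerDl ltW.
  by rewrite ds lerDr powR_ge0.
Qed.

End NullSets.

(** * Values of digit sequences *)

Lemma powR_exprVn (R : realType) (q s : R) (k : nat) : 0 < q -> (q ^- k) `^ s = (q `^ s) ^- k.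
Proof.
move=> q0; have Q0 : 0 < q `^ s by apply: powR_gt0.
have Qk : (q ^+ k) `^ s = (q `^ s) ^+ k.
  by rewrite -powR_mulrn ?ltW// -powRrM mulrC powRrM powR_mulrn// ltW.
have Hk : (q ^+ k) `^ s != 0 by rewrite gt_eqF// powR_gt0// exprn_gt0.
apply: (mulIf Hk); rewrite {2}Qk mulVf -?Qk// -powRM ?invr_ge0 ?exprn_ge0 ?(ltW q0)//.
by rewrite mulVf ?powR1// expf_neq0// gt_eqF.
Qed.

Section Expansions.
Variable R : realType.
Variable M : nat.
Implicit Types (q r : R) (x y c : nat -> nat) (n m i : nat).

Definition psum q x n : R := \sum_(0 <= i < n) (x i)%:R * q ^- i.+1.
Definition qval q x : R := limn (psum q x).

Lemma digit_shift x n : digit_seq M x -> digit_seq M (shift n x).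
Proof. by move=> dx i; exact: dx. Qed.

Lemma digit_reflect x : digit_seq M (reflect_seq M x).
Proof. by move=> i; exact: leq_subr. Qed.

Lemma shiftS n x : shift n (shift 1 x) = shift n.+1 x.
Proof. by apply/funext => i; rewrite /shift addnA add1n. Qed.

Lemma shift0 x : shift 0 x = x.
Proof. by apply/funext => i; rewrite /shift add0n. Qed.

Lemma shift_shift n m x : shift n (shift m x) = shift (m + n) x.
Proof. by apply/funext => i; rewrite /shift addnA. Qed.

Lemma reflectK x : digit_seq M x -> reflect_seq M (reflect_seq M x) = x.
Proof. by move=> dx; apply/funext => i; rewrite /reflect_seq subKn. Qed.

Lemma psumS q x n : q != 0 -> psum q x n.+1 = ((x 0%N)%:R + psum q (shift 1 x) n) / q.
Proof.
move=> q0; rewrite /psum big_nat_recl//= expr1 mulrDl; congr (_ + _).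
rewrite mulr_suml; apply: eq_bigr => i _.
by rewrite /shift add1n exprS invfM mulrA mulrAC.
Qed.

Lemma psum_le q x n : 1 < q -> digit_seq M x -> psum q x n <= M%:R / (q - 1).
Proof.
move=> q1; have q0 : 0 < q by lra.
have qn0 : q != 0 by rewrite gt_eqF.
elim: n x => [|n IH] x dx.
  by rewrite /psum big_geq// divr_ge0//; lra.
rewrite psumS// ler_pdivrMr//.
have := IH _ (digit_shift 1 dx).
have : (x 0%N)%:R <= M%:R :> R by rewrite ler_nat.
have -> : M%:R / (q - 1) * q = M%:R + M%:R / (q - 1) :> R by field; lra.
lra.
Qed.

Lemma psum_nd q x n m : 1 < q -> (n <= m)%N -> psum q x n <= psum q x m.
Proof.
move=> q1; elim: m => [|m IH]; first by rewrite leqn0 => /eqP ->.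
rewrite leq_eqVlt => /orP[/eqP->//|]; rewrite ltnS => /IH nm.
apply: le_trans nm _; rewrite [in leRHS]/psum big_nat_recr//= lerDl.
by rewrite mulr_ge0// invr_ge0 exprn_ge0//; lra.
Qed.

Lemma psum_cvg q x : 1 < q -> digit_seq M x -> psum q x @ \oo --> qval q x.
Proof.
move=> q1 dx; apply: nondecreasing_is_cvgn.
  by move=> n m; exact: psum_nd.
by exists (M%:R / (q - 1)) => _ [n _ <-]; exact: psum_le.
Qed.

Lemma is_expansionP q x r : 1 < q -> is_expansion M q x r <-> digit_seq M x /\ r = qval q x.
Proof.
move=> q1; split=> [[dx cx]|[dx ->]]; split => //.
  by apply/esym/cvg_lim.
exact: psum_cvg.
Qed.

Lemma qval_cons q x : 1 < q -> digit_seq M x -> qval q x = ((x 0%N)%:R + qval q (shift 1 x)) / q.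
Proof.
move=> q1 dx; have qn0 : q != 0 by lra.
apply: cvg_lim => //; rewrite -cvg_shiftS /=.
under eq_fun do rewrite psumS//.
apply: cvgM; last exact: cvg_cst.
by apply: cvgD; [exact: cvg_cst|apply: psum_cvg => //; exact: digit_shift].
Qed.

Lemma qval_shift q x : 1 < q -> digit_seq M x -> qval q (shift 1 x) = q * qval q x - (x 0%N)%:R.
Proof. by move=> q1 dx; rewrite (qval_cons q1 dx); field; lra. Qed.

Lemma qval_le q x : 1 < q -> digit_seq M x -> qval q x <= M%:R / (q - 1).
Proof.
move=> q1 dx; apply: limr_le; first by apply/cvg_ex; exists (qval q x); exact: psum_cvg.
by apply: nearW => n; exact: psum_le.
Qed.

Lemma psum_qval q x n : 1 < q -> digit_seq M x -> psum q x n <= qval q x.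
Proof.
move=> q1 dx; apply: nondecreasing_cvgn_le.
  by move=> a b; exact: psum_nd.
by apply/cvg_ex; exists (qval q x); exact: psum_cvg.
Qed.

Lemma qval_ge0 q x : 1 < q -> digit_seq M x -> 0 <= qval q x.
Proof.
by move=> q1 dx; have := psum_qval 0 q1 dx; rewrite /psum big_geq.
Qed.

Lemma qval_split q x n : 1 < q -> digit_seq M x ->
  qval q x = psum q x n + q ^- n * qval q (shift n x).
Proof.
move=> q1; have qn0 : q != 0 by lra.
elim: n x => [|n IH] x dx.
  by rewrite /psum big_geq// add0r expr0 invr1 mul1r shift0.
rewrite qval_cons// (IH _ (digit_shift 1 dx)) psumS// shiftS exprS invfM.
by rewrite !mulrDl !addrA; congr (_ + _); rewrite mulrC mulrA.
Qed.

Lemma qval_gt0 q x : 1 < q -> digit_seq M x -> not_ending_in_0 x -> 0 < qval q x.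
Proof.
move=> q1 dx /(_ 0%N)[m [_ /eqP xm]].
apply: lt_le_trans (psum_qval m.+1 q1 dx).
rewrite /psum big_nat_recr//= ltr_wpDl//.
  by apply: sumr_ge0 => i _; rewrite mulr_ge0// invr_ge0 exprn_ge0//; lra.
by rewrite mulr_gt0 ?ltr0n ?lt0n// invr_gt0 exprn_gt0//; lra.
Qed.

Lemma psum_eq q x y n : (forall i, (i < n)%N -> x i = y i) -> psum q x n = psum q y n.
Proof. by move=> xy; apply: eq_big_nat => i /andP[_ /xy ->]. Qed.

Lemma expr_unbounded (q a : R) : 1 < q -> exists n, a < q ^+ n.
Proof.
move=> q1; have : (fun n => q^-1 ^+ n) @ \oo --> (0 : R).
  by apply: cvg_expr; rewrite ger0_norm ?invr_ge0 ?invf_lt1//; lra.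
move=> /cvgrPdist_lt/(_ ((`|a| + 1)^-1)) [].
  by rewrite invr_gt0 ltr_wpDl.
move=> N _ /(_ N (leqnn N)) /=.
have qN : 0 < q ^+ N by rewrite exprn_gt0//; lra.
rewrite sub0r normrN exprVn ger0_norm ?invr_ge0 ?ltW// ltf_pV2 ?posrE ?ltr_wpDl// => H.
by exists N; apply: le_lt_trans H; rewrite (le_trans (ler_norm a))// lerDl.
Qed.

Lemma small_inv_expr (q a e : R) : 1 < q -> 0 < e -> exists n, forall m, (n <= m)%N -> a * q ^- m < e.
Proof.
move=> q1 e0; have [n Hn] := expr_unbounded (a / e) q1.
exists n => m nm.
rewrite ltr_pdivrMr ?exprn_gt0//; last by lra.
rewrite -ltr_pdivrMl// mulrC; apply: lt_le_trans Hn _.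
by rewrite ler_weXn2l// ltW.
Qed.

Lemma qval_close q x y n : 1 < q -> digit_seq M x -> digit_seq M y ->
  (forall i, (i < n)%N -> x i = y i) -> `|qval q x - qval q y| <= M%:R / (q - 1) * q ^- n.
Proof.
move=> q1 dx dy xy; rewrite (qval_split n q1 dx) (qval_split n q1 dy) (psum_eq q xy).
have -> : forall a b c : R, a + b - (a + c) = b - c by move=> *; ring.
rewrite -mulrBr normrM ger0_norm ?invr_ge0 ?exprn_ge0//; last by lra.
rewrite [leRHS]mulrC ler_wpM2l ?invr_ge0 ?exprn_ge0//; first by lra.
have := qval_le q1 (digit_shift n dx); have := qval_le q1 (digit_shift n dy).
have := qval_ge0 q1 (digit_shift n dx); have := qval_ge0 q1 (digit_shift n dy).
by rewrite ler_norml; move=> *; lra.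
Qed.

Lemma qval_reflect q x : 1 < q -> digit_seq M x -> qval q (reflect_seq M x) = M%:R / (q - 1) - qval q x.
Proof.
(* The error is divided by q at each shift, so any uniform starting bound suffices; 3M/(q-1) is a
   crude one. *)
move=> q1 dx; suff H n : `|qval q (reflect_seq M x) + qval q x - M%:R / (q - 1)| <= M%:R / (q - 1) * 3 * q ^- n.
  apply/eqP; rewrite -subr_eq0 -normr_eq0 eq_le normr_ge0 andbT.
  apply/ler_addgt0Pr => e e0; rewrite add0r.
  have [n Hn] := small_inv_expr (M%:R / (q - 1) * 3) q1 e0.
  apply: le_trans (ltW (Hn n (leqnn n))); apply: le_trans (H n).
  by rewrite opprB addrA.
elim: n x dx => [|n IH] x dx.
  have := qval_le q1 dx; have := qval_ge0 q1 dx.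
  have := qval_le q1 (digit_reflect x); have := qval_ge0 q1 (digit_reflect x).
  by rewrite expr0 invr1 mulr1 ler_norml => *; lra.
have := IH _ (digit_shift 1 dx).
have q0 : 0 < q by lra.
rewrite (qval_cons q1 dx) (qval_cons q1 (digit_reflect x)).
have -> : shift 1 (reflect_seq M x) = reflect_seq M (shift 1 x) by [].
rewrite {2}/reflect_seq natrB//.
set a := qval _ _; set b := qval _ _ => H.
have -> : (M%:R - (x 0%N)%:R + a) / q + ((x 0%N)%:R + b) / q - M%:R / (q - 1) =
   (a + b - M%:R / (q - 1)) / q by field; lra.
rewrite normrM [X in _ * X]ger0_norm ?invr_ge0 ?(ltW q0)// exprSr invfM mulrA.
by rewrite ler_wpM2r// invr_ge0 ltW.
Qed.

End Expansions.

(** * Lexicographic order and quasi-greedy expansions *)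

Section Lex.
Implicit Types (x y z c : nat -> nat) (n m k : nat).

Definition agree k x y := forall i, (i < k)%N -> x i = y i.

Lemma agree_sym k x y : agree k x y -> agree k y x.
Proof. by move=> xy i ik; rewrite xy. Qed.

Lemma agree_trans k x y z : agree k x y -> agree k y z -> agree k x z.
Proof. by move=> xy yz i ik; rewrite xy// yz. Qed.

Lemma agree_le k m x y : (k <= m)%N -> agree m x y -> agree k x y.
Proof. by move=> km xy i ik; apply: xy; exact: leq_trans km. Qed.

Lemma agree_shift k n x y : agree (n + k) x y -> agree k (shift n x) (shift n y).
Proof. by move=> xy i ik; apply: xy; rewrite ltn_add2l. Qed.

Lemma lex_total x y : x = y \/ lex_lt x y \/ lex_lt y x.
Proof.
have [[n nxy]|H] := pselect (exists n, x n != y n); last first.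
  left; apply/funext => n; apply/eqP; apply/negPn/negP => nxy; apply: H.
  by exists n.
right; have ex : exists n, x n != y n by exists n.
case: (ex_minnP ex) => m xym mmin.
have ag i : (i < m)%N -> x i = y i.
  move=> im; apply/eqP; apply/negPn/negP => /mmin; by rewrite leqNgt im.
move: xym; rewrite neq_ltn => /orP[xy|yx]; [left|right]; exists m; split => //.
by move=> i im; rewrite ag.
Qed.

Lemma lex_lt_trans x y z : lex_lt x y -> lex_lt y z -> lex_lt x z.
Proof.
move=> [n [xy nxy]] [m [yz myz]]; have [nm|mn|nm] := ltngtP n m.
- by exists n; split => [i ilt|]; [rewrite xy// yz// (ltn_trans ilt)|rewrite -yz].
- by exists m; split => [i ilt|]; [rewrite xy ?yz// (ltn_trans ilt)|rewrite xy].
- subst m; exists n; split => [i ilt|]; first by rewrite xy// yz.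
  exact: ltn_trans myz.
Qed.

Lemma lex_lt_irr x : ~ lex_lt x x.
Proof. by move=> [n [_]]; rewrite ltnn. Qed.

Lemma lex_leE x y : lex_le x y <-> x = y \/ lex_lt x y.
Proof. by split=> [[/funext|]|[->|]]; [left|right|left|right]. Qed.

Lemma lex_ltW x y : lex_lt x y -> lex_le x y.
Proof. by right. Qed.

Lemma lex_le_refl x : lex_le x x.
Proof. by left. Qed.

Lemma lex_lt_le_trans x y z : lex_lt x y -> lex_le y z -> lex_lt x z.
Proof. by move=> xy /lex_leE[<-//|]; exact: lex_lt_trans. Qed.

Lemma lex_le_trans x y z : lex_le x y -> lex_le y z -> lex_le x z.
Proof. by move=> /lex_leE[->//|xy] yz; right; exact: lex_lt_le_trans yz. Qed.

Lemma lex_leNlt x y : lex_le x y <-> ~ lex_lt y x.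
Proof.
split=> [xy yx|]; first exact: (lex_lt_irr (lex_lt_le_trans yx xy)).
by move=> H; apply/lex_leE; case: (lex_total x y) => [|[|//]]; [left|right].
Qed.

Lemma lex_le_anti x y : lex_le x y -> lex_le y x -> x = y.
Proof. by move=> /lex_leE[//|xy] /lex_leNlt. Qed.

Lemma lex_lt_reflect M x y : digit_seq M y -> lex_lt x y ->
  lex_lt (reflect_seq M y) (reflect_seq M x).
Proof.
move=> dy [n [xy nxy]]; exists n; split => [i /xy|]; rewrite /reflect_seq; first by move->.
by apply: ltn_sub2l => //; apply: leq_trans nxy _; exact: dy.
Qed.

Lemma lex_le_reflect M x y : digit_seq M y -> lex_le x y ->
  lex_le (reflect_seq M y) (reflect_seq M x).
Proof. by move=> dy /lex_leE[->|xy]; [left|right; exact: lex_lt_reflect]. Qed.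

Lemma lex_prefix_lt k x y : lex_le x y -> ~ agree k x y ->
  exists n, [/\ (n < k)%N, agree n x y & (x n < y n)%N].
Proof.
move=> /lex_leE[->|[n [xy nxy]]] nag; first by case: nag.
exists n; split => //; rewrite ltnNge; apply/negP => kn; apply: nag.
exact: agree_le xy.
Qed.

(** Grafting and the passage to a smaller base rest on this: a comparison decided within a prefix
    does not see the tails. *)
Lemma lex_lt_agree k n x y x' y' : agree n x y -> (x n < y n)%N -> (n < k)%N ->
  agree k x x' -> agree k y y' -> lex_lt x' y'.
Proof.
move=> xy nxy nk xx yy; exists n; split; last by rewrite -xx// -yy.
by move=> i ilt; rewrite -xx ?(ltn_trans ilt)// -yy ?(ltn_trans ilt)// xy.
Qed.

Lemma lex_squeeze k x y z : lex_le x y -> lex_le y z -> agree k x z -> agree k x y.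
Proof.
move=> xy yz xz; have [//|nag] := pselect (agree k x y).
have [n [nk ag lt]] := lex_prefix_lt xy nag.
have : lex_lt z y by apply: (lex_lt_agree ag lt nk xz).
by move/lex_leNlt: yz.
Qed.

Lemma lex_le_shift k x y : lex_le x y -> agree k x y -> lex_le (shift k x) (shift k y).
Proof.
move=> /lex_leE[->|[n [xy nxy]]] ag; first by left.
have kn : (k <= n)%N by rewrite leqNgt; apply/negP => /ag E; rewrite E ltnn in nxy.
right; exists (n - k)%N; rewrite /shift; split; last by rewrite subnKC.
by move=> i ilt; apply: xy; rewrite -ltn_subRL.
Qed.

Lemma lex_le_unshift k x y : agree k x y -> lex_le (shift k x) (shift k y) -> lex_le x y.
Proof.
move=> ag /lex_leE[E|[n [xy nxy]]].
  apply/lex_leE; left; apply/funext => i; have [/ag//|ki] := ltnP i k.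
  by have := congr1 (@^~ (i - k)%N) E; rewrite /shift subnKC.
right; exists (k + n)%N; split => // i ilt; have [/ag//|ki] := ltnP i k.
by have := xy (i - k)%N; rewrite /shift subnKC// => -> //; rewrite ltn_subLR.
Qed.

End Lex.

(** * Quasi-greedy expansions and the sequence alpha(q) *)

Section QuasiGreedy.
Variable R : realType.
Variable M : nat.
Implicit Types (p q r : R) (x y c a b : nat -> nat) (n m i : nat).

(** The strict inequality below t keeps the next remainder positive, which distinguishes the
    quasi-greedy choice from the greedy one. *)
Lemma quasi_greedy_digit (t : R) : 0 < t -> exists d, [/\ (d <= M)%N, d%:R < t & (d < M)%N -> t <= d.+1%:R].
Proof.
move=> t0; elim: M => [|m [d [dm dt H]]]; first by exists 0%N.
have [/H td|md] := ltnP d m; first by exists d; split => //; exact: leqW.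
have [tm|mt] := leP t m.+1%:R.
  by exists m; split => //; rewrite (_ : m = d)//; apply/eqP; rewrite eqn_leq md.
by exists m.+1; rewrite ltnn.
Qed.

Lemma qval_eq0 q x : 1 < q -> digit_seq M x -> (forall i, x i = 0%N) -> qval q x = 0.
Proof.
move=> q1 dx x0; apply: cvg_lim => //.
rewrite (_ : psum q x = fun=> 0); first exact: cvg_cst.
by apply/funext => n; rewrite /psum big1// => i _; rewrite x0 mul0r.
Qed.

Lemma base_ge1 q : 1 < q <= M.+1%:R -> 1 <= M%:R / (q - 1).
Proof. by move=> /andP[q1 qM]; rewrite ler_pdivlMr ?subr_gt0// mul1r lerBlDr natr1. Qed.

(** The remainders stay in (0, M/(q-1)]. Positivity excludes a tail of zeros, and a digit below M is
    chosen only when the remainder after it is at most 1. *)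
Lemma quasi_greedy_expansion q r : 1 < q <= M.+1%:R -> 0 < r <= M%:R / (q - 1) ->
  exists x, [/\ digit_seq M x, not_ending_in_0 x, qval q x = r &
    forall n, (x n < M)%N -> qval q (shift n.+1 x) <= 1].
Proof.
move=> hq /andP[r0 rM]; have /andP[q1 qM] := hq.
have q0 : 0 < q by lra.
have /choice[D HD] : forall u : R, exists d, 0 < u ->
    [/\ (d <= M)%N, d%:R < q * u & (d < M)%N -> q * u <= d.+1%:R].
  move=> u; have [u0|] := ltP 0 u; last by exists 0%N.
  by have [d Hd] := quasi_greedy_digit (mulr_gt0 q0 u0); exists d.
pose f u := q * u - (D u)%:R.
pose rem n := iter n f r.
pose x n := D (rem n).
have remS n : rem n.+1 = q * rem n - (x n)%:R by [].
have remB n : 0 < rem n <= M%:R / (q - 1).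
  elim: n => [|n /andP[n0 nM]]; first by rewrite /rem /= r0.
  rewrite remS /x; have [dM dlt dge] := HD _ n0.
  rewrite subr_gt0 dlt /=; move: dM; rewrite leq_eqVlt => /orP[/eqP ->|/dge].
    rewrite lerBlDr; have -> : M%:R / (q - 1) + M%:R = q * (M%:R / (q - 1)) by field; lra.
    by rewrite ler_pM2l.
  rewrite -natr1 => H; apply: le_trans (base_ge1 hq); lra.
have dx : digit_seq M x by move=> n; have /andP[/HD[]] := remB n.
(* Tail value and remainder obey the same recursion and are both bounded, so their difference,
   multiplied by q at each step, vanishes. *)
have val n : qval q (shift n x) = rem n.
  apply/eqP; rewrite -subr_eq0 -normr_eq0 eq_le normr_ge0 andbT.
  apply/ler_addgt0Pr => e e0; rewrite add0r.
  have [k Hk] := small_inv_expr (M%:R / (q - 1)) q1 e0.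
  apply: le_trans (ltW (Hk k (leqnn k))) => {Hk}.
  elim: k n => [|k IH] n.
    have dn := digit_shift n dx.
    have /andP[n0 nM] := remB n; have := qval_le q1 dn; have := qval_ge0 q1 dn.
    by rewrite expr0 invr1 mulr1 ler_norml => *; lra.
  have dn := digit_shift n dx.
  have := IH n.+1; rewrite -addn1 -shift_shift (qval_shift q1 dn).
  have -> : shift n x 0%N = x n by rewrite /shift addn0.
  rewrite addn1 remS.
  have -> : q * qval q (shift n x) - (x n)%:R - (q * rem n - (x n)%:R) = q * (qval q (shift n x) - rem n) by ring.
  rewrite normrM (ger0_norm (ltW q0)) mulrC -ler_pdivlMr// => H.
  by apply: le_trans H _; rewrite exprSr invfM mulrA.
exists x; split => //.
- move=> n; have [H|H] := pselect (exists m, (n <= m)%N /\ x m <> 0%N) => //.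
  have /andP[+ _] := remB n; rewrite -val (qval_eq0 q1 (digit_shift n dx)) ?ltxx// => i.
  have [//|xi] := pselect (x (n + i)%N = 0%N); exfalso; apply: H.
  by exists (n + i)%N; split => //; exact: leq_addr.
- by have := val 0%N; rewrite shift0.
- move=> n xn; rewrite val remS.
  have /andP[n0 _] := remB n; have [_ _ /(_ xn)] := HD _ n0.
  by rewrite -/(x n) -natr1 lerBlDl.
Qed.

Lemma ne0_shift n x : not_ending_in_0 x -> not_ending_in_0 (shift n x).
Proof.
move=> nx k; have [m [km xm]] := nx (n + k)%N.
have nm : (n <= m)%N by apply: leq_trans km; exact: leq_addr.
exists (m - n)%N; split; first by rewrite leq_subRL.
by rewrite /shift subnKC.
Qed.

Lemma qval_shift_split q x n : 1 < q -> digit_seq M x ->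
  qval q x = psum q x n + q ^- n.+1 * ((x n)%:R + qval q (shift n.+1 x)).
Proof.
move=> q1 dx; rewrite (qval_split n q1 dx) (qval_cons q1 (digit_shift n dx)) shift_shift addn1.
have -> : shift n x 0%N = x n by rewrite /shift addn0.
by rewrite exprS invfM; ring.
Qed.

Lemma qval_lex_diff q x y n (z : R) : 1 < q -> digit_seq M x -> digit_seq M y ->
  agree n x y -> z = (y n)%:R + qval q (shift n.+1 y) - ((x n)%:R + qval q (shift n.+1 x)) ->
  qval q y - qval q x = q ^- n.+1 * z.
Proof.
move=> q1 dx dy xy ->.
by rewrite (qval_shift_split n q1 dx) (qval_shift_split n q1 dy) (psum_eq q xy); ring.
Qed.

(** The quasi-greedy output is maximal: a larger [b] first differing at n has a digit at least one
    larger and a positive tail, while the tail of [a] after a digit below M is at most 1. *)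
Lemma alpha_exists q : 1 < q <= M.+1%:R -> exists a, is_alpha M q a.
Proof.
move=> hq; have /andP[q1 qM] := hq.
have [|a [da na va ta]] := @quasi_greedy_expansion q 1 hq; first by rewrite ltr01 base_ge1.
exists a; split; first by apply/is_expansionP.
split => // b /(is_expansionP _ _ _ q1)[db vb] nb.
apply/lex_leNlt => -[n [ab nab]].
have bM : (a n < M)%N by apply: leq_trans nab (db n).
have := qval_lex_diff q1 da db ab erefl; rewrite va -vb subrr => /esym/eqP.
rewrite mulf_eq0 invr_eq0 expf_eq0 /= gt_eqF ?andbF/=; last by lra.
have := ta _ bM; have : 0 < qval q (shift n.+1 b).
  by apply: qval_gt0 q1 (digit_shift _ db) (ne0_shift _ nb).
have : (a n).+1%:R <= (b n)%:R :> R by rewrite ler_nat.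
by rewrite -natr1 => h1 h2 h3 /eqP h4; lra.
Qed.

Lemma alpha_unique q a b : is_alpha M q a -> is_alpha M q b -> a = b.
Proof. by move=> [ea [na ha]] [eb [nb hb]]; apply: lex_le_anti; [exact: hb|exact: ha]. Qed.

Section Alpha.
Variables (q : R) (a : nat -> nat).
Hypotheses (hq : 1 < q <= M.+1%:R) (ha : is_alpha M q a).

Lemma alpha_digit : digit_seq M a.
Proof. by case: ha => -[]. Qed.

Lemma alpha_ne0 : not_ending_in_0 a.
Proof. by case: ha => _ []. Qed.

Lemma alpha_val : qval q a = 1.
Proof.
have /andP[q1 _] := hq. by have [/(is_expansionP _ _ _ q1)[_ <-]] := ha. Qed.

Lemma alpha_tail_gt0 n : 0 < qval q (shift n a).
Proof.
have /andP[q1 _] := hq. exact: qval_gt0 q1 (digit_shift _ alpha_digit) (ne0_shift _ alpha_ne0). Qed.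

(** After a digit below M this is the quasi-greedy choice; after a digit M a tail t <= 1 becomes q t
    - M <= q - M <= 1. *)
Lemma alpha_tail n : qval q (shift n a) <= 1.
Proof.
have /andP[q1 _] := hq.
have /andP[_ qM] := hq.
have [|b [db nb vb tb]] := @quasi_greedy_expansion q 1 hq; first by rewrite ltr01 base_ge1.
have la : lex_le b a by case: ha => _ [_]; apply => //; exact/is_expansionP.
have ab : b = a.
  case/lex_leE : la => // -[m [ba mba]]; exfalso.
  have bM : (b m < M)%N by apply: leq_trans mba (alpha_digit m).
  have := qval_lex_diff q1 db alpha_digit ba erefl; rewrite vb alpha_val subrr => /esym/eqP.
  rewrite mulf_eq0 invr_eq0 expf_eq0 /= gt_eqF ?andbF/=; last by lra.
  have := tb _ bM; have := alpha_tail_gt0 m.+1.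
  have : (b m).+1%:R <= (a m)%:R :> R by rewrite ler_nat.
  by rewrite -natr1 => h1 h2 h3 /eqP h4; lra.
elim: n => [|n IH]; first by rewrite shift0 alpha_val.
have [aM|] := ltnP (a n) M; first by rewrite -ab; apply: tb; rewrite ab.
move=> Ma; have -> : shift n.+1 a = shift 1 (shift n a) by rewrite shift_shift addn1.
rewrite (qval_shift q1 (digit_shift n alpha_digit)) {2}/shift addn0.
have : M%:R <= (a n)%:R :> R by rewrite ler_nat.
have : q * qval q (shift n a) <= q * 1 by rewrite ler_pM2l//; lra.
by move: qM; rewrite -natr1; lra.
Qed.

Lemma alpha_lt_val c : digit_seq M c -> lex_lt a c ->
  exists n, 1 + q ^- n.+1 * qval q (shift n.+1 c) <= qval q c.
Proof.
have /andP[q1 _] := hq.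
move=> dc [n [ac nac]]; exists n.
have := qval_lex_diff q1 alpha_digit dc ac erefl; rewrite alpha_val => H.
rewrite -lerBrDl H ler_pM2l; last by rewrite invr_gt0 exprn_gt0//; lra.
have : (a n).+1%:R <= (c n)%:R :> R by rewrite ler_nat.
by rewrite -natr1; have := alpha_tail n.+1; lra.
Qed.

Lemma lt_alpha_of_val c : digit_seq M c -> qval q c < 1 -> lex_lt c a.
Proof.
have /andP[q1 _] := hq.
move=> dc c1; case: (lex_total c a) => [ca|[//|/(alpha_lt_val dc)[n]]].
  by move: c1; rewrite ca alpha_val ltxx.
have := qval_ge0 q1 (digit_shift n.+1 dc); rewrite -(@pmulr_rge0 _ (q ^- n.+1)).
  by lra.
by rewrite invr_gt0 exprn_gt0//; lra.
Qed.

Lemma qval_le1 c : digit_seq M c -> (forall n, lex_le (shift n c) a) -> qval q c <= 1.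
Proof.
have /andP[q1 _] := hq.
move=> dc hc; have [q0 K0] : 0 < q /\ 0 <= M%:R / (q - 1).
  by split; [lra|apply: le_trans (base_ge1 hq)].
(* All shifts are bounded at once: at the first digit where a shift drops below [a], the excess of
   its tail over 1 is divided by a power of q, so each round gains a factor q. *)
suff H k n : qval q (shift n c) <= 1 + M%:R / (q - 1) * q ^- k.
  apply/ler_addgt0Pr => e e0.
  have [k Hk] := small_inv_expr (M%:R / (q - 1)) q1 e0.
  by have := H k 0%N; have := Hk k (leqnn k); rewrite shift0; lra.
elim: k n => [|k IH] n.
  by have := qval_le q1 (digit_shift n dc); rewrite expr0 invr1 mulr1; lra.
have B0 : 0 <= M%:R / (q - 1) * q ^- k by rewrite mulr_ge0// invr_ge0 exprn_ge0// ltW.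
have Bk : 0 <= M%:R / (q - 1) * q ^- k.+1 by rewrite mulr_ge0// invr_ge0 exprn_ge0// ltW.
have /lex_leE[->|[m [ac mac]]] := hc n; first by rewrite alpha_val lerDl.
have dn := digit_shift n dc.
have := qval_lex_diff q1 dn alpha_digit ac erefl; rewrite alpha_val => H.
have qm : 0 < q ^- m.+1 by rewrite invr_gt0 exprn_gt0.
have : qval q (shift n c) <= 1 + q ^- m.+1 * (M%:R / (q - 1) * q ^- k).
  suff : 0 <= q ^- m.+1 * (M%:R / (q - 1) * q ^- k) + q ^- m.+1 *
     ((a m)%:R + qval q (shift m.+1 a) - ((shift n c m)%:R + qval q (shift m.+1 (shift n c)))) by lra.
  rewrite -mulrDr pmulr_rge0//.
  have : (shift n c m).+1%:R <= (a m)%:R :> R by rewrite ler_nat.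
  rewrite -natr1 shift_shift; have := IH (n + m.+1)%N; have := alpha_tail_gt0 m.+1; lra.
move/le_trans; apply; rewrite lerD2l.
have -> : M%:R / (q - 1) * q ^- k.+1 = q^-1 * (M%:R / (q - 1) * q ^- k).
  by rewrite exprS invfM; ring.
rewrite ler_wpM2r// lef_pV2 ?posrE ?exprn_gt0// exprS ler_peMr ?(ltW q0)//.
by apply: exprn_ege1; lra.
Qed.

Lemma qval_lt1 c : digit_seq M c -> (forall n, lex_le (shift n c) a) -> c <> a -> qval q c < 1.
Proof.
have /andP[q1 _] := hq.
move=> dc hc ca; have := hc 0%N; rewrite shift0 => /lex_leE[//|[m [ac mac]]].
have := qval_lex_diff q1 dc alpha_digit ac erefl; rewrite alpha_val => H.
rewrite -subr_gt0 H pmulr_rgt0 ?invr_gt0 ?exprn_gt0//; last by lra.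
have : (c m).+1%:R <= (a m)%:R :> R by rewrite ler_nat.
rewrite -natr1; have := alpha_tail_gt0 m.+1.
have : qval q (shift m.+1 c) <= 1; last by lra.
by apply: qval_le1; [exact: digit_shift|move=> n; rewrite shift_shift].
Qed.

End Alpha.

(** One factor p/q is extracted from each term and q^-i <= p^-i does the rest; this factor yields
    the strict inequality in [alpha_lt]. *)
Lemma qval_base_lt p q x : 1 < p -> p < q -> digit_seq M x -> qval q x <= p / q * qval p x.
Proof.
move=> p1 pq dx; have q1 : 1 < q by lra.
have cp : (fun n => p / q * psum p x n) @ \oo --> p / q * qval p x.
  by apply: cvgM; [exact: cvg_cst|exact: (psum_cvg p1 dx)].
apply: (ler_cvg_to (psum_cvg q1 dx) cp).
  apply: nearW => n; rewrite mulr_sumr; apply: ler_sum => i _.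
  rewrite mulrCA ler_wpM2l// !exprS !invfM mulrA.
  have -> : p / q / p = q^-1 by field; lra.
  apply: ler_wpM2l; first by rewrite invr_ge0; lra.
  rewrite lef_pV2 ?posrE ?exprn_gt0//; try lra.
  by apply: lerXn2r; rewrite ?nnegrE; lra.
Qed.

Lemma alpha_lt p q a b : 1 < p -> p < q <= M.+1%:R -> is_alpha M p a -> is_alpha M q b ->
  lex_lt a b.
Proof.
move=> p1 /andP[pq qM] hpa hqb.
have hp : 1 < p <= M.+1%:R by rewrite p1; lra.
have hq : 1 < q <= M.+1%:R by rewrite qM andbT; lra.
apply: (lt_alpha_of_val hq hqb (alpha_digit hpa)).
apply: le_lt_trans (qval_base_lt p1 pq (alpha_digit hpa)) _.
by rewrite (alpha_val hp hpa) mulr1 ltr_pdivrMr; lra.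
Qed.

Lemma psum_continuous x n q : q != 0 -> (fun p => psum p x n) @ q --> psum q x n.
Proof.
move=> q0; elim: n => [|n IH].
  rewrite /psum big_geq//; under eq_fun do rewrite big_geq//.
  exact: cvg_cst.
rewrite /psum big_nat_recr//=; under eq_fun do rewrite big_nat_recr//=.
apply: cvgD => //; apply: cvgM; first exact: cvg_cst.
by apply: cvgV; [rewrite expf_neq0|exact: exprn_continuous].
Qed.

(** Left continuity of alpha: the n-prefix padded with zeros has value below 1 at q, because the
    discarded tail is positive, and hence also at some p < q. Then alpha(p) lies between the padded
    prefix and alpha(q). *)
Lemma alpha_left_approx q a n : 1 < q <= M.+1%:R -> is_alpha M q a ->
  exists p, 1 < p < q /\ forall b, is_alpha M p b -> agree n a b.
Proof.
move=> hq ha; have /andP[q1 qM] := hq.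
have s1 : psum q a n < 1.
  have := qval_split n q1 (alpha_digit ha); rewrite (alpha_val hq ha) => ->.
  rewrite ltrDl mulr_gt0 ?(alpha_tail_gt0 hq ha)// invr_gt0 exprn_gt0//; lra.
have qn0 : q != 0 by lra.
have /cvgrPdist_lt Hc := @psum_continuous a n q qn0.
have s2 : 0 < 1 - psum q a n by rewrite subr_gt0.
case: (Hc _ s2) => e /= e0 He.
pose d := Num.min (e / 2) ((q - 1) / 2).
have d0 : 0 < d by rewrite lt_min !divr_gt0//; lra.
have de : d < e by rewrite gt_min; apply/orP; left; lra.
have dq : d < q - 1 by rewrite gt_min; apply/orP; right; lra.
exists (q - d); split; first by apply/andP; lra.
have := He (q - d); rewrite /ball /= opprB addrC subrK ger0_norm ?(ltW d0)// => /(_ de).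
have p1 : 1 < q - d by lra.
have hp : 1 < q - d <= M.+1%:R by lra.
move=> H b hb.
have sp : psum (q - d) a n < 1 by move: H; rewrite ltr_norml; lra.
pose c i := if (i < n)%N then a i else 0%N.
have dc : digit_seq M c by move=> i; rewrite /c; case: ifP => // _; exact: alpha_digit ha i.
have ac : agree n c a by move=> i ilt; rewrite /c ilt.
have cb : lex_lt c b.
  apply: (lt_alpha_of_val hp hb dc).
  rewrite (qval_split n p1 dc) (psum_eq _ ac) (qval_eq0 p1 (digit_shift n dc)).
    by rewrite mulr0 addr0.
  by move=> i; rewrite /c /shift ltnNge leq_addr.
have ba : lex_lt b a by apply: alpha_lt p1 _ hb ha; lra.
apply: agree_trans (agree_sym ac) _.
exact: lex_squeeze (lex_ltW cb) (lex_ltW ba) ac.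
Qed.

End QuasiGreedy.

(** * Symbolic and univoque sets *)

Section SymbolicSets.
Variable R : realType.
Variable M : nat.
Implicit Types (q s : R) (x y z c a b : nat -> nat) (u w : seq nat) (n m i : nat).
Implicit Types (P Q : set (nat -> nat)).

(** [Vq] with its bound as a parameter, so that the same facts serve alpha(p), alpha(q) and lambda
    without reference to a base. *)
Definition bounded_by b : set (nat -> nat) :=
  [set x | digit_seq M x /\
     forall n, lex_le (reflect_seq M b) (shift n x) /\ lex_le (shift n x) b].

Lemma Vq_bounded_by q a : is_alpha M q a -> Vq M q = bounded_by a.
Proof.
move=> ha; apply/seteqP; split => x [dx H]; split => //.
  by case: H => b [hb]; rewrite (alpha_unique ha hb).
by exists a.
Qed.

Lemma reflect_shift n x : reflect_seq M (shift n x) = shift n (reflect_seq M x).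
Proof. by []. Qed.

Lemma bounded_by_shift n b x : bounded_by b x -> bounded_by b (shift n x).
Proof.
by move=> [dx H]; split; [exact: digit_shift|move=> m; rewrite shift_shift].
Qed.

Lemma bounded_by_reflect b x : digit_seq M b -> bounded_by b x -> bounded_by b (reflect_seq M x).
Proof.
move=> db [dx H]; split; first exact: digit_reflect.
move=> n; rewrite -reflect_shift; have [lo hi] := H n; split.
  by apply: lex_le_reflect.
rewrite -(reflectK db); apply: lex_le_reflect => //; exact: digit_shift.
Qed.

Lemma bounded_by_mono b b' : digit_seq M b' -> lex_le b b' -> bounded_by b `<=` bounded_by b'.
Proof.
move=> db bb x [dx H]; split => // n; have [lo hi] := H n; split.
  by apply: lex_le_trans lo; exact: lex_le_reflect.
exact: lex_le_trans bb.
Qed.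

Lemma lex_le_closed x b : (forall n, exists y, agree n x y /\ lex_le y b) -> lex_le x b.
Proof.
move=> H; apply/lex_leNlt => -[n [bx nbx]].
have [y [xy yb]] := H n.+1; apply: (proj1 (lex_leNlt _ _) yb).
by apply: (lex_lt_agree bx nbx (ltnSn n) _ xy) => i.
Qed.

Lemma lex_ge_closed x b : (forall n, exists y, agree n x y /\ lex_le b y) -> lex_le b x.
Proof.
move=> H; apply/lex_leNlt => -[n [bx nbx]].
have [y [xy yb]] := H n.+1; apply: (proj1 (lex_leNlt _ _) yb).
by apply: (lex_lt_agree bx nbx (ltnSn n) xy) => i.
Qed.

(** Closedness in the product topology, in the prefix form that [finite_subcover] requires. *)
Lemma bounded_by_closed b x :
  (forall n, exists y, agree n x y /\ bounded_by b y) -> bounded_by b x.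
Proof.
move=> H; split.
  by move=> i; have [y [xy [dy _]]] := H i.+1; rewrite xy.
move=> n; split; [apply: lex_ge_closed|apply: lex_le_closed] => k;
  have [y [xy [dy /(_ n)[lo hi]]]] := H (n + k)%N; exists (shift n y); split => //;
  exact: agree_shift.
Qed.

Definition wcat u c i := if (i < size u)%N then nth 0%N u i else c (i - size u)%N.

Lemma shift_wcat u c : shift (size u) (wcat u c) = c.
Proof. by apply/funext => i; rewrite /shift /wcat ltnNge leq_addr /= addKn. Qed.

Lemma agree_wcat u c : agree (size u) (wcat u c) (nth 0%N u).
Proof. by move=> i iu; rewrite /wcat iu. Qed.

Lemma agree_mkseq x n : agree n x (nth 0%N (mkseq x n)).
Proof. by move=> i ni; rewrite nth_mkseq. Qed.

Lemma wcat_mkseq_agree x c n : agree n (wcat (mkseq x n) c) x.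
Proof. by move=> i ni; rewrite /wcat size_mkseq ni nth_mkseq. Qed.

Lemma shift_wcat_mkseq x c n : shift n (wcat (mkseq x n) c) = c.
Proof. by rewrite -[X in shift X _](size_mkseq x n) shift_wcat. Qed.

Lemma digit_wcat x c n : digit_seq M x -> digit_seq M c -> digit_seq M (wcat (mkseq x n) c).
Proof.
move=> dx dc i; rewrite /wcat size_mkseq; case: ltnP => ni; last exact: dc.
by rewrite nth_mkseq.
Qed.

Definition snull s q P := null s [set qval q x | x in P].

Lemma snull_sub s q P Q : P `<=` Q -> snull s q Q -> snull s q P.
Proof. by move=> PQ; apply: null_sub => _ [x /PQ Qx <-]; exists x. Qed.

Lemma snull_le s t q P : 0 < s -> s <= t -> snull s q P -> snull t q P.
Proof. exact: null_le. Qed.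

Lemma snull_bigcup (I : countType) s q P (Q : I -> set (nat -> nat)) : 0 < s ->
  P `<=` \bigcup_j Q j -> (forall j, snull s q (Q j)) -> snull s q P.
Proof.
move=> s0 PQ nQ; apply: null_sub (null_bigcup s0 nQ).
by move=> _ [x /PQ[i _ Qx] <-]; exists i => //; exists x.
Qed.

Lemma snullU s q P Q : 0 < s -> snull s q P -> snull s q Q -> snull s q (P `|` Q).
Proof.
move=> s0 nP nQ; apply: (@snull_bigcup bool _ _ _ (fun b : bool => if b then P else Q)) => //.
  by move=> x [Px|Qx]; [exists true|exists false].
by case.
Qed.

Lemma snull1 s q x : 0 < s -> snull s q [set x].
Proof.
by move=> s0; apply: null_sub (null_point (qval q x) s0) => _ [_ -> <-].
Qed.

(** There are countably many prefixes, and prepending a fixed one acts on values by an affine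
    map. *)
Lemma snull_eventually s q P : 0 < s -> 1 < q -> snull s q P ->
  snull s q [set x | digit_seq M x /\ exists n, P (shift n x)].
Proof.
move=> s0 q1 nP.
apply: (@snull_bigcup (seq nat) _ _ _ (fun u => [set x | [/\ digit_seq M x,
   agree (size u) x (nth 0%N u) & P (shift (size u) x)]])) => //.
  move=> x [dx [n Pn]]; exists (mkseq x n) => //.
  by rewrite /= size_mkseq; split => //; exact: agree_mkseq.
move=> u; have := null_affine (q ^- size u) (psum q (nth 0%N u) (size u)) s0 nP.
apply: null_sub => _ [x [dx xu Px] <-].
exists (qval q (shift (size u) x)); first by exists (shift (size u) x).
by rewrite (qval_split (size u) q1 dx) (psum_eq _ xu) addrC.
Qed.

Lemma snull_prefix s q u P : 0 < s -> 1 < q -> (forall c, P c -> digit_seq M (wcat u c)) ->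
  null s [set qval q (wcat u c) | c in P] -> snull s q P.
Proof.
move=> s0 q1 dP nP.
have qn0 : q ^+ size u != 0 by rewrite expf_neq0//; lra.
apply: null_sub (null_affine (q ^+ size u) (- q ^+ size u * psum q (nth 0%N u) (size u)) s0 nP).
move=> _ [c Pc <-]; exists (qval q (wcat u c)); first by exists c.
rewrite (qval_split (size u) q1 (dP _ Pc)) (psum_eq _ (@agree_wcat u c)) shift_wcat.
by rewrite mulrDr mulrA mulfV// mul1r mulNr addrAC subrr add0r.
Qed.

Lemma snull_reflect s q P : 0 < s -> 1 < q -> P `<=` digit_seq M -> snull s q P ->
  snull s q [set reflect_seq M x | x in P].
Proof.
move=> s0 q1 dP nP.
apply: null_sub (null_affine (-1) (M%:R / (q - 1)) s0 nP).
move=> _ [_ [x Px <-] <-]; exists (qval q x); first by exists x.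
by rewrite (qval_reflect q1 (dP _ Px)) mulN1r addrC.
Qed.

(** Words may have unequal lengths, as in the Thue-Morse covering; only their common lower bound [L]
    enters the estimate. *)
Lemma snull_word_cover s q P : 0 < s -> 1 < q -> P `<=` digit_seq M ->
  (forall e, 0 < e -> exists (L : nat) (W : seq (seq nat)),
     (forall x, P x -> exists w, [/\ w \in W, (L <= size w)%N & agree (size w) x (nth 0%N w)]) /\
     (size W)%:R * (M%:R / (q - 1) * q ^- L) `^ s <= e) ->
  snull s q P.
Proof.
move=> s0 q1 dP H; apply: null_fin_cover => // e /H[L [W [cov le]]].
exists (size W), (fun i => [set qval q x | x in [set x | P x /\ agree L x (nth 0%N (nth [::] W i))]]).
exists (M%:R / (q - 1) * q ^- L); split => //.
- move=> _ [x Px <-]; have [w [wW Lw xw]] := cov _ Px.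
  exists (index w W); first by rewrite /= index_mem.
  by exists x => //; split => //; rewrite nth_index//; exact: agree_le xw.
- by rewrite mulr_ge0// ?divr_ge0// ?invr_ge0 ?exprn_ge0//; lra.
- move=> i _ _ [x [Px xw] <-] [y [Py yw] <-].
  apply: qval_close => //; [exact: dP|exact: dP|].
  exact: agree_trans (agree_sym yw).
Qed.

End SymbolicSets.

(** * Unique expansions and the tails of their digit sequences *)

Section Univoque.
Variable R : realType.
Variable M : nat.
Implicit Types (q s r : R) (x y z c : nat -> nat) (n m i : nat).

(* A digit below M can be raised, changing the expansion but not its value, exactly when the tail after it has value at least 1; dually for lowering a positive digit. *)
Definition univoque_cond q x :=
  (forall n, (x n < M)%N -> qval q (shift n.+1 x) < 1) /\
  (forall n, (0 < x n)%N -> qval q (reflect_seq M (shift n.+1 x)) < 1).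

Lemma univoque_cond_reflect q x : digit_seq M x -> univoque_cond q x -> univoque_cond q (reflect_seq M x).
Proof.
move=> dx [H1 H2]; split => n; rewrite {1}/reflect_seq => h.
  by apply: H2; rewrite -subn_gt0 in h; move: h; rewrite subKn.
rewrite -reflect_shift reflectK; last exact: digit_shift.
by apply: H1; rewrite -subn_gt0.
Qed.

Lemma Uq_intro q x : 1 < q -> digit_seq M x -> univoque_cond q x -> Uq M q (qval q x).
Proof.
move=> q1 dx [H1 H2]; split; first by rewrite (qval_ge0 q1 dx) (qval_le q1 dx).
have qn k : q ^- k.+1 != 0 by rewrite invr_eq0 expf_neq0//; lra.
exists x; split; first by apply/is_expansionP.
move=> y /(is_expansionP _ _ _ q1)[dy vy]; case: (lex_total x y) => [->//|[]] [n [xy nxy]].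
  have := qval_lex_diff q1 dx dy xy erefl; rewrite vy subrr => /esym/eqP.
  rewrite mulf_eq0 (negPf (qn _)) /= => /eqP E.
  have := H1 n (leq_trans nxy (dy n)); have := qval_ge0 q1 (digit_shift n.+1 dy).
  have : (x n).+1%:R <= (y n)%:R :> R by rewrite ler_nat.
  by rewrite -natr1; lra.
have := qval_lex_diff q1 dy dx xy erefl; rewrite vy subrr => /esym/eqP.
rewrite mulf_eq0 (negPf (qn _)) /= => /eqP E.
have := H2 n (leq_ltn_trans (leq0n _) nxy); rewrite (qval_reflect q1 (digit_shift _ dx)).
have := qval_le q1 (digit_shift n.+1 dy).
have : (y n).+1%:R <= (x n)%:R :> R by rewrite ler_nat.
by rewrite -natr1; lra.
Qed.

Lemma unique_tail_lt1 q x : 1 < q <= M.+1%:R -> digit_seq M x ->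
  (forall y, digit_seq M y -> qval q y = qval q x -> y = x) ->
  forall n, (x n < M)%N -> qval q (shift n.+1 x) < 1.
Proof.
move=> hq dx ux n xn; have /andP[q1 _] := hq.
have dt := digit_shift n.+1 dx.
rewrite ltNge; apply/negP => t1.
(* With a tail of at least 1, digit n can be raised and the tail replaced by an expansion of its
   value minus 1. The value 0 is separate, since quasi-greedy expansions exist for positive numbers
   only. *)
have [z [dz vz]] : exists z, digit_seq M z /\ qval q z = qval q (shift n.+1 x) - 1.
  move: t1; rewrite le_eqVlt => /orP[/eqP <-|t1].
    by exists (fun=> 0%N); split => //; rewrite subrr (@qval_eq0 R M).
  have [|z [dz _ vz _]] := @quasi_greedy_expansion R M q (qval q (shift n.+1 x) - 1) hq.
    by rewrite subr_gt0 t1 /=; have := qval_le q1 dt; lra.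
  by exists z.
pose y i := if (i < n)%N then x i else if i == n then (x n).+1 else z (i - n.+1)%N.
have dy : digit_seq M y by move=> i; rewrite /y; case: ifP => // _; case: ifP.
have xy : agree n x y by move=> i ilt; rewrite /y ilt.
have yn : y n = (x n).+1 by rewrite /y ltnn eqxx.
have ys : shift n.+1 y = z.
  apply/funext => i; rewrite /shift /y.
  have -> : (n.+1 + i < n)%N = false by lia.
  have -> : (n.+1 + i == n)%N = false by lia.
  by rewrite addKn.
have := qval_lex_diff q1 dx dy xy erefl; rewrite yn ys vz -natr1.
rewrite [X in _ * X](_ : _ = 0) ?mulr0; last by ring.
move/eqP; rewrite subr_eq0 => /eqP /(ux _ dy) yx.
by move: yn; rewrite yx => /eqP; rewrite eqn_leq ltnn andbF.
Qed.

Lemma Uq_elim q r : 1 < q <= M.+1%:R -> Uq M q r ->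
  exists x, [/\ digit_seq M x, r = qval q x & univoque_cond q x].
Proof.
move=> hq [_ [x [ex ux]]]; have /andP[q1 _] := hq.
have [dx vx] := (is_expansionP _ _ _ q1).1 ex.
have u y : digit_seq M y -> qval q y = qval q x -> y = x.
  by move=> dy vy; apply/esym/funext/ux/is_expansionP => //; rewrite vy.
exists x; split => //; split; first exact: unique_tail_lt1.
move=> n xn; rewrite reflect_shift; apply: (unique_tail_lt1 hq (digit_reflect M x)).
  move=> y dy; rewrite (qval_reflect q1 dx) => vy.
  rewrite -(u (reflect_seq M y)) ?reflectK//; first exact: digit_reflect.
  by rewrite (qval_reflect q1 dy) vy; ring.
by rewrite /reflect_seq; have := dx n; lia.
Qed.

(** The bound passes through digits equal to M: there a tail t < 1 becomes q t - M < q - M <= 1. One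
    digit below M thus controls all later tails. *)
Lemma univoque_tail q x i : 1 < q <= M.+1%:R -> digit_seq M x -> univoque_cond q x ->
  (x i < M)%N -> forall n, (i < n)%N -> qval q (shift n x) < 1.
Proof.
move=> /andP[q1 qM] dx [H1 _] xi; elim=> // n IH; rewrite ltnS leq_eqVlt => /orP[/eqP <-|/IH xn].
  exact: H1.
have [/H1//|Mx] := ltnP (x n) M.
rewrite -addn1 -shift_shift (qval_shift q1 (digit_shift n dx)) /shift addn0 -/(shift n x).
have : M%:R <= (x n)%:R :> R by rewrite ler_nat.
have : q * qval q (shift n x) <= q * 1 by rewrite ler_pM2l// ?(ltW xn)//; lra.
have : q * qval q (shift n x) < q * 1 by rewrite ltr_pM2l//; lra.
by move: qM; rewrite -natr1; lra.
Qed.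

Section Base.
Variables (q : R) (a : nat -> nat).
Hypotheses (hq : 1 < q <= M.+1%:R) (ha : is_alpha M q a).

Definition strict_tails x := forall n, lex_lt (shift n x) a /\ lex_lt (reflect_seq M (shift n x)) a.

Lemma strict_tails_bounded x : digit_seq M x -> strict_tails x -> bounded_by M a x.
Proof.
move=> dx H; split => // n; have [h1 h2] := H n; split; last exact: lex_ltW.
rewrite -(reflectK (digit_shift n dx)); apply: lex_le_reflect; last exact: lex_ltW.
exact: alpha_digit ha.
Qed.

Lemma univoque_cases x : digit_seq M x -> univoque_cond q x ->
  [\/ x = fun=> 0%N, x = fun=> M | exists N, strict_tails (shift N x)].
Proof.
move=> dx ux.
have [[i xi]|H1] := pselect (exists i, (x i < M)%N); last first.
  apply: Or32; apply/funext => i; apply/eqP; rewrite eqn_leq dx /= leqNgt; apply/negP => xi.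
  by apply: H1; exists i.
have [[j xj]|H2] := pselect (exists j, (0 < x j)%N); last first.
  apply: Or31; apply/funext => j; apply/eqP; rewrite eqn_leq leq0n andbT leqNgt; apply/negP => xj.
  by apply: H2; exists j.
apply: Or33; exists (maxn i j).+1 => n; rewrite shift_shift; split.
  apply: (lt_alpha_of_val hq ha); first exact: digit_shift.
  by apply: (univoque_tail hq dx ux xi); have := leq_maxl i j; lia.
apply: (lt_alpha_of_val hq ha); first exact: digit_reflect.
rewrite reflect_shift; apply: (univoque_tail hq (digit_reflect M x) (univoque_cond_reflect dx ux) (i := j)).
  by rewrite /reflect_seq; have := dx j; lia.
by have := leq_maxr i j; lia.
Qed.

Lemma snull_univoque s : 0 < s -> snull s q (bounded_by M a) -> null s (Uq M q).
Proof.
move=> s0 nV; have /andP[q1 _] := hq.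
apply: null_sub (snullU s0 (snullU s0 (snull1 q (fun=> 0%N) s0) (snull1 q (fun=> M) s0))
   (@snull_eventually _ M _ _ _ s0 q1 nV)).
move=> _ /(Uq_elim hq)[x [dx -> ux]]; exists x => //.
case: (univoque_cases dx ux) => [xc|xc|[N sx]]; [left; left|left; right|right] => //.
split => //; exists N; apply: strict_tails_bounded => //; exact: digit_shift.
Qed.

(** The countable exceptional set: a tail equal to alpha has value exactly 1, where the strict
    inequalities of [univoque_cond] can fail. *)
Definition alpha_ended : set (nat -> nat) :=
  [set x | digit_seq M x /\ exists n, shift n x = a \/ shift n x = reflect_seq M a].

Lemma snull_alpha_ended s : 0 < s -> snull s q alpha_ended.
Proof.
move=> s0; have /andP[q1 _] := hq.
apply: snull_sub (@snull_eventually _ M _ _ _ s0 q1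
  (snullU s0 (snull1 q a s0) (snull1 q (reflect_seq M a) s0))).
by move=> x [dx [n H]]; split => //; exists n.
Qed.

Lemma bounded_tail_lt1 x n : bounded_by M a x -> ~ alpha_ended x ->
  qval q (shift n x) < 1 /\ qval q (reflect_seq M (shift n x)) < 1.
Proof.
move=> Vx nx; have dx : digit_seq M x by case: Vx.
split; apply: (qval_lt1 hq ha).
- exact: digit_shift.
- by move=> m; rewrite shift_shift; case: Vx => _ /(_ (n + m)%N)[].
- by move=> E; apply: nx; split => //; exists n; left.
- exact: digit_reflect.
- have [_ H] := bounded_by_reflect (alpha_digit ha) (bounded_by_shift n Vx).
  by move=> m; case: (H m).
- move=> E; apply: nx; split => //; exists n; right.
  by rewrite -E reflectK//; exact: digit_shift.
Qed.

End Base.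
End Univoque.

(** * Entropy *)

Section Fekete.
Variable R : realType.

Lemma subadditive_mul (u : nat -> R) (k m r : nat) : (forall n m, u (n + m)%N <= u n + u m) ->
  u (k * m + r)%N <= m%:R * u k + u r.
Proof.
move=> sub; elim: m => [|m IH]; first by rewrite muln0 add0n mul0r add0r.
rewrite mulnS -addnA; apply: le_trans (sub _ _) _.
by rewrite -natr1 mulrDl mul1r; lra.
Qed.

(** Fekete's lemma; the limit is the infimum of the quotients, so the word count at any single
    length bounds the entropy from above. *)
Lemma fekete (u : nat -> R) : (forall n, 0 <= u n) -> (forall n m, u (n + m)%N <= u n + u m) ->
  exists l, (fun n => u n / n%:R) @ \oo --> l /\ forall k, l <= u k.+1 / k.+1%:R.
Proof.
move=> u0 sub; pose S := [set u k.+1 / k.+1%:R | k in [set: nat]].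
have lS : lbound S 0 by move=> _ [k _ <-]; rewrite divr_ge0.
have hS : has_inf S by split; [exists (u 1%N / 1); exists 0%N|exists 0].
have linf k : inf S <= u k.+1 / k.+1%:R by apply: ge_inf; [exists 0|exists k].
exists (inf S); split => //; apply/cvgrPdist_le => e e0.
have e20 : 0 < e / 2 by rewrite divr_gt0.
have [_ [k _ <-] hk] := inf_adherent e20 hS.
(* [B] bounds the contribution of every remainder modulo k+1; once n exceeds 2B/e it costs at most
   e/2. *)
pose B := \sum_(r < k.+1) u r.
have uB r : (r < k.+1)%N -> u r <= B.
  by move=> rk; rewrite /B (bigD1 (Ordinal rk))//= lerDl sumr_ge0.
have B0 : 0 <= B by rewrite sumr_ge0.
exists (Num.truncn (2 * B / e)).+1 => // n /= Nn.
have Nn' : 2 * B / e < n%:R.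
  apply: lt_le_trans (_ : (Num.truncn (2 * B / e)).+1%:R <= _); last by rewrite ler_nat.
  exact: truncnS_gt.
have n0 : (0 < n)%N by apply: leq_trans Nn.
have nR0 : (0 : R) < n%:R by rewrite ltr0n.
rewrite ler_norml; apply/andP; split; last first.
  by have := linf n.-1; rewrite prednK//; lra.
have := @subadditive_mul u k.+1 (n %/ k.+1) (n %% k.+1) sub.
rewrite mulnC -divn_eq => un.
have ur : u (n %% k.+1)%N <= B by apply: uB; rewrite ltn_mod.
have km : (n %/ k.+1)%N%:R * k.+1%:R <= n%:R :> R by rewrite -natrM ler_nat leq_divM.
have H1 : (n %/ k.+1)%N%:R * u k.+1 <= n%:R * (u k.+1 / k.+1%:R).
  have -> : (n %/ k.+1)%N%:R * u k.+1 = (n %/ k.+1)%N%:R * k.+1%:R * (u k.+1 / k.+1%:R).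
    by rewrite -mulrA (mulrC k.+1%:R) divfK// pnatr_eq0.
  by rewrite ler_wpM2r// divr_ge0.
have H2 : u n / n%:R <= u k.+1 / k.+1%:R + B / n%:R.
  rewrite ler_pdivrMr// mulrDl (divfK (negbT (gt_eqF nR0))) (mulrC _ n%:R).
  by apply: le_trans un _; exact: lerD.
have H3 : B / n%:R <= e / 2.
  by rewrite ler_pdivrMr//; move: Nn'; rewrite ltr_pdivrMr//; lra.
move: H2 H3 hk; set A := u n / _; set C := u k.+1 / _; set D := B / _; lra.
Qed.

End Fekete.

Section Entropy.
Variable R : realType.
Variable M : nat.
Implicit Types (p q t : R) (x y : nat -> nat) (n m k : nat).

Lemma Vq_shift q n x : Vq M q x -> Vq M q (shift n x).
Proof.
move=> [dx [a [ha H]]]; split; first exact: digit_shift.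
by exists a; split => // m; rewrite shift_shift.
Qed.

Lemma Vq_digit q : Vq M q `<=` digit_seq M.
Proof. by move=> x []. Qed.

(** Shift invariance of [Vq] turns words occurring at any position into prefixes, the form in which
    covers use them. *)
Lemma words_exist q n : exists W : seq (seq nat),
  [/\ uniq W, size W = nwords M q n & forall w, w \in W <-> exists x, Vq M q x /\ w = mkseq x n].
Proof.
pose A := [set w : n.-tuple 'I_M.+1 |
     `[< exists x k, Vq M q x /\ forall i : 'I_n, x (k + i)%N = nat_of_ord (tnth w i) >]]%SET.
pose f (w : n.-tuple 'I_M.+1) : seq nat := [seq nat_of_ord j | j <- w].
have finj : injective f.
  move=> w1 w2 /inj_map E; apply/val_inj/E; exact: val_inj.
exists [seq f w | w <- enum A]; split.
- by rewrite map_inj_uniq// enum_uniq.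
- rewrite size_map -cardE /nwords; apply: eq_card => w; rewrite !inE.
  rewrite unfold_in /in_set; apply/asboolP/asboolP => [H|]; first exact/asboolP.
  by move=> /asboolP.
move=> w; split.
  move=> /mapP[v]; rewrite mem_enum inE => /asboolP[x [k [Vx H]]] ->.
  exists (shift k x); split; first exact: Vq_shift.
  apply: (@eq_from_nth _ 0%N); first by rewrite size_map size_tuple size_mkseq.
  move=> i; rewrite size_map size_tuple => ilt.
  rewrite nth_mkseq// /shift (H (Ordinal ilt)) (tnth_nth ord0).
  by rewrite (nth_map ord0)// size_tuple.
move=> [x [Vx ->]]; have dx := Vq_digit Vx.
pose v : n.-tuple 'I_M.+1 := [tuple inord (x i) | i < n].
have vE i : nat_of_ord (tnth v i) = x i by rewrite tnth_mktuple inordK// ltnS.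
apply/mapP; exists v.
  by rewrite mem_enum inE; apply/asboolP; exists x, 0%N; split => // i; rewrite vE.
apply: (@eq_from_nth _ 0%N); first by rewrite size_mkseq size_map size_tuple.
move=> i; rewrite size_mkseq => ilt.
rewrite nth_mkseq// (nth_map ord0) ?size_tuple// -(vE (Ordinal ilt)).
by rewrite (tnth_nth ord0).
Qed.

Lemma nwords_le q n (W : seq (seq nat)) : (forall x, Vq M q x -> mkseq x n \in W) ->
  (nwords M q n <= size W)%N.
Proof.
move=> H; have [L [uL <- mL]] := words_exist q n.
by apply: uniq_leq_size => // w /mL[x [Vx ->]]; exact: H.
Qed.

Lemma nwords_gt0P q n : (0 < nwords M q n)%N <-> exists x, Vq M q x.
Proof.
have [L [uL <- mL]] := words_exist q n; split.
  case: L mL {uL} => // w L mL _; have /mL[x [Vx _]] : w \in w :: L by rewrite mem_head.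
  by exists x.
move=> [x Vx]; have : mkseq x n \in L by apply/mL; exists x.
by case: L {uL mL}.
Qed.

Lemma mkseqD x n m : mkseq x (n + m) = mkseq x n ++ mkseq (shift n x) m.
Proof.
apply: (@eq_from_nth _ 0%N); first by rewrite size_cat !size_mkseq.
move=> i; rewrite size_mkseq => ilt; rewrite nth_mkseq// nth_cat size_mkseq.
case: ltnP => ni; first by rewrite nth_mkseq.
by rewrite nth_mkseq ?ltn_subLR// /shift subnKC.
Qed.

Lemma nwordsD q n m : (nwords M q (n + m) <= nwords M q n * nwords M q m)%N.
Proof.
have [L1 [_ <- m1]] := words_exist q n; have [L2 [_ <- m2]] := words_exist q m.
rewrite -(size_allpairs (fun u v => u ++ v)); apply: nwords_le => x Vx.
rewrite mkseqD; apply: allpairs_f; [apply/m1|apply/m2]; first by exists x.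
by exists (shift n x); split => //; exact: Vq_shift.
Qed.

Lemma nwords_mono p q n : Vq M p `<=` Vq M q -> (nwords M p n <= nwords M q n)%N.
Proof.
move=> pq; have [L [_ <- mL]] := words_exist q n.
by apply: nwords_le => x /pq Vx; apply/mL; exists x.
Qed.

(** By the convention ln 0 = 0 this includes a word count of 0, which occurs exactly when [Vq] is
    empty. *)
Lemma ln_nat_ge0 n : 0 <= ln n%:R :> R.
Proof.
by case: n => [|n]; [rewrite ln0|rewrite ln_ge0// ler1n].
Qed.

Lemma ln_nat_le n m : (n <= m)%N -> ln n%:R <= ln m%:R :> R.
Proof.
case: n => [|n] nm; first by rewrite ln0// ln_nat_ge0.
by rewrite ler_ln ?posrE ?ltr0n ?ler_nat// (leq_trans _ nm).
Qed.

Lemma Hent_lim q : (fun n => ln (nwords M q n)%:R / n%:R) @ \oo --> Hent M q /\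
  forall k, Hent M q <= ln (nwords M q k.+1)%:R / k.+1%:R.
Proof.
have [n|n m|l [cl hl]] := @fekete R (fun n => ln (nwords M q n)%:R).
- exact: ln_nat_ge0.
- have := nwordsD q n m; case: (posnP (nwords M q (n + m))) => [->|np].
    by rewrite ln0// addr_ge0// ln_nat_ge0.
  have [x Vx] := (nwords_gt0P q (n + m)).1 np => H.
  have n0 : (0 < nwords M q n)%N by apply/nwords_gt0P; exists x.
  have m0 : (0 < nwords M q m)%N by apply/nwords_gt0P; exists x.
  rewrite -lnM ?posrE ?ltr0n// -natrM; exact: ln_nat_le.
- have El : Hent M q = l by exact: cvg_lim cl.
  by rewrite El.
Qed.

Lemma Hent_sub p q : Vq M p `<=` Vq M q -> Hent M p <= Hent M q.
Proof.
move=> pq; apply: (ler_cvg_to (Hent_lim p).1 (Hent_lim q).1).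
apply: nearW => n; rewrite ler_wpM2r ?invr_ge0//.
by apply: ln_nat_le; exact: nwords_mono.
Qed.

Lemma Vq_mono p q : 1 < p -> p <= q <= M.+1%:R -> Vq M p `<=` Vq M q.
Proof.
move=> p1 /andP[pq qM]; move: pq; rewrite le_eqVlt => /orP[/eqP->//|pq].
have [|b hb] := @alpha_exists R M q; first by apply/andP; split => //; lra.
move=> x [dx [a [ha H]]].
rewrite (Vq_bounded_by hb); apply: (@bounded_by_mono M a b); last by split.
  exact: alpha_digit hb.
by apply/lex_ltW/(alpha_lt p1 _ ha hb); rewrite pq.
Qed.

Lemma Hent_mono p q : 1 < p -> p <= q <= M.+1%:R -> Hent M p <= Hent M q.
Proof. by move=> p1 pq; apply/Hent_sub/Vq_mono. Qed.

Lemma Hent_ge0 q : 0 <= Hent M q.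
Proof.
apply: (ler_cvg_to (cvg_cst 0) (Hent_lim q).1).
by apply: nearW => n; rewrite divr_ge0// ln_nat_ge0.
Qed.

(** About exp(L H(p)) cylinders cover V_p, each contributing a multiple of exp(-L t log q). The rate
    [h], midway between the two, absorbs the error in the entropy limit. *)
Lemma snull_entropy p q t : 0 < t -> 1 < q -> Hent M p < t * ln q -> snull t q (Vq M p).
Proof.
move=> t0 q1 Ht; apply: (@snull_word_cover R M) => //; first exact: Vq_digit.
move=> e e0; have q0 : 0 < q by lra.
have K0 : 0 <= M%:R / (q - 1) by rewrite divr_ge0//; lra.
pose h := (Hent M p + t * ln q) / 2.
have hH : Hent M p < h by rewrite /h; lra.
have hb : 1 < expR (t * ln q - h) by rewrite expR_gt1 /h; lra.
have [n Hn] := small_inv_expr ((M%:R / (q - 1)) `^ t) hb e0.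
have [+ _] := Hent_lim p; move=> /(cvgr_lt (Hent M p))/(_ _ hH)[N _ HN].
pose L := (maxn n N).+1; exists L.
have HL : ln (nwords M p L)%:R / L%:R < h by apply: HN; rewrite /= /L; lia.
have [W [_ sW mW]] := words_exist p L; exists W; split.
  move=> x Vx; exists (mkseq x L); rewrite size_mkseq; split => //.
    by apply/mW; exists x.
  exact: agree_mkseq.
rewrite sW; apply: le_trans (ltW (Hn L _)); last by rewrite /L; lia.
rewrite powRM// ?invr_ge0 ?exprn_ge0 ?(ltW q0)// mulrCA ler_wpM2l ?powR_ge0//.
have -> : (q ^- L) `^ t = expR (- (L%:R * (t * ln q))).
  rewrite /powR gt_eqF ?invr_gt0 ?exprn_gt0// lnV ?posrE ?exprn_gt0// lnXn//.
  by congr expR; rewrite mulrN -mulr_natl; ring.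
have -> : expR (t * ln q - h) ^- L = expR (L%:R * h) * expR (- (L%:R * (t * ln q))).
  rewrite -expRM_natl -expRN -expRD; congr expR; ring.
rewrite ler_wpM2r ?expR_ge0//.
case: (posnP (nwords M p L)) => [->|np]; first exact: expR_ge0.
rewrite -[leLHS]lnK ?posrE ?ltr0n// ler_expR.
by move: HL; rewrite ltr_pdivrMr ?ltr0n// mulrC => /ltW.
Qed.

End Entropy.

(** * Lower bound for the dimension of V_q *)

Section Koenig.
Variable M : nat.
Implicit Types (x y : nat -> nat) (w : seq nat).

(** Koenig's lemma: a word whose cylinder defeats every finite subfamily can be prolonged by a
    digit, since there are finitely many digits. The infinite path lies in the closed set [P], so a
    single cylinder covers it, a contradiction. *)
Lemma finite_subcover (P : set (nat -> nat)) (m : nat -> nat) (z : nat -> nat -> nat) :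
  P `<=` digit_seq M ->
  (forall x, (forall n, exists y, agree n x y /\ P y) -> P x) ->
  (forall x, P x -> exists i, agree (m i) x (z i)) ->
  exists N, forall x, P x -> exists i, (i < N)%N /\ agree (m i) x (z i).
Proof.
move=> dP cP cov; apply/not_existsP => nfin.
pose bad w := forall N, exists x, [/\ P x, agree (size w) x (nth 0%N w) &
   forall i, (i < N)%N -> ~ agree (m i) x (z i)].
have bad0 : bad [::].
  move=> N; have /existsNP[x /not_implyP[Px H]] := nfin N.
  by exists x; split => // i iN xz; apply: H; exists i.
have badS w : bad w -> exists d, bad (rcons w d).
  move=> bw; apply/not_existsP => nb.
  have /choice[N HN] : forall d, exists N, forall x, P x ->
      agree (size w).+1 x (nth 0%N (rcons w d)) -> exists i, (i < N)%N /\ agree (m i) x (z i).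
    move=> d; have /existsNP[N HN] := nb d; exists N => x Px xw.
    apply/not_existsP => H; apply: HN; exists x; split; rewrite ?size_rcons//.
    by move=> i iN xz; apply: (H i).
  have [x [Px xw H]] := bw (\max_(d < M.+1) N d)%N.
  have xM : (x (size w) < M.+1)%N by rewrite ltnS; exact: dP.
  have [|i [iN xz]] := HN (x (size w)) x Px.
    move=> i; rewrite ltnS leq_eqVlt nth_rcons => /orP[/eqP ->|ilt].
      by rewrite ltnn eqxx.
    by rewrite ilt xw.
  apply: (H i) xz; apply: leq_trans iN _.
  exact: (@leq_bigmax _ (fun d : 'I_M.+1 => N d) (Ordinal xM)).
have /choice[D HD] : forall w, exists d, bad w -> bad (rcons w d).
  by move=> w; have [/badS[d Hd]|nb] := pselect (bad w); [exists d|exists 0%N].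
pose W n := iter n (fun w => rcons w (D w)) [::].
have WS n : W n.+1 = rcons (W n) (D (W n)) by [].
have sW n : size (W n) = n by elim: n => // n IH; rewrite WS size_rcons IH.
have bW n : bad (W n) by elim: n => // n IH; rewrite WS; exact: HD.
pose y n := D (W n).
have Wy n : agree n y (nth 0%N (W n)).
  elim: n => // n IH i; rewrite ltnS leq_eqVlt WS nth_rcons sW => /orP[/eqP ->|ilt].
    by rewrite ltnn eqxx.
  by rewrite ilt IH.
have Py : P y.
  apply: cP => n; have [x [Px]] := bW n 0%N; rewrite sW => xW _.
  by exists x; split => //; apply: agree_trans (Wy n) (agree_sym xW).
have [i yz] := cov _ Py; have [x [_ xW]] := bW (m i) i.+1.
move=> /(_ i (ltnSn i)); apply; rewrite sW in xW.
exact: agree_trans xW (agree_trans (agree_sym (Wy _)) yz).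
Qed.

End Koenig.

Section Furstenberg.
Variable R : realType.
Variable M : nat.
Variables (q : R) (a : nat -> nat).
Hypotheses (hq : 1 < q < M.+1%:R) (ha : is_alpha M q a).
Implicit Types (x y : nat -> nat) (n m i : nat).

(** Values of V_q lie between [gap] and 1. After a first difference the larger digit gains at least
    1, and its tail loses at most 1 - [gap] against the other, so a distance [gap] remains, up to
    scaling. *)
Let gap := M%:R / (q - 1) - 1.

Lemma base_range : 1 < q <= M.+1%:R.
Proof. by case/andP: hq => -> /ltW. Qed.

Lemma gap_gt0 : 0 < gap.
Proof.
have /andP[q1 qM] := hq.
by rewrite subr_gt0 ltr_pdivlMr ?subr_gt0// mul1r ltrBlDr natr1.
Qed.

Lemma bounded_qval_le1 x : bounded_by M a x ->
  qval q x <= 1 /\ M%:R / (q - 1) - 1 <= qval q x.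
Proof.
have /andP[q1 qM] := hq => Vx; have dx : digit_seq M x by case: Vx.
split.
  by apply: (qval_le1 base_range ha dx) => n; case: Vx => _ /(_ n)[].
have [_ H] := bounded_by_reflect (alpha_digit ha) Vx.
have := qval_le1 base_range ha (digit_reflect M x) (fun n => (H n).2).
by rewrite (qval_reflect q1 dx); lra.
Qed.

Lemma bounded_separation x y n : bounded_by M a x -> bounded_by M a y ->
  agree n x y -> x n <> y n -> gap * q ^- n.+1 <= `|qval q x - qval q y|.
Proof.
have /andP[q1 qM] := hq.
have qn : 0 < q ^- n.+1 by rewrite invr_gt0 exprn_gt0//; lra.
have main x' y' : bounded_by M a x' -> bounded_by M a y' -> agree n x' y' ->
    (x' n < y' n)%N -> gap * q ^- n.+1 <= qval q y' - qval q x'.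
  move=> Vx Vy xy nxy; have [dx dy] : digit_seq M x' /\ digit_seq M y' by case: Vx Vy => ? _ [].
  rewrite (qval_lex_diff q1 dx dy xy erefl) mulrC ler_pM2l//.
  have [h1 _] := bounded_qval_le1 (bounded_by_shift n.+1 Vx).
  have [_ h2] := bounded_qval_le1 (bounded_by_shift n.+1 Vy).
  have : (x' n).+1%:R <= (y' n)%:R :> R by rewrite ler_nat.
  by rewrite -natr1 /gap; lra.
move=> Vx Vy xy /eqP; rewrite neq_ltn => /orP[lt|lt].
  by rewrite distrC; apply: le_trans (ler_norm _); exact: main.
by apply: le_trans (ler_norm _); apply: main => //; exact: agree_sym.
Qed.

Lemma bounded_agree x y n (c : R) : bounded_by M a x -> bounded_by M a y ->
  `|qval q x - qval q y| <= c -> c < gap * q ^- n -> agree n x y.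
Proof.
have /andP[q1 qM] := hq.
move=> Vx Vy xyc cn; elim: n cn => // n IH cn.
have cn' : c < gap * q ^- n.
  apply: lt_le_trans cn _; rewrite ler_pM2l ?gap_gt0// lef_pV2 ?posrE ?exprn_gt0//; try lra.
  by rewrite exprS ler_peMl ?exprn_ge0//; lra.
move=> i; rewrite ltnS leq_eqVlt => /orP[/eqP ->|]; last exact: IH.
have [//|ne] := pselect (x n = y n); exfalso.
by have := bounded_separation Vx Vy (IH cn') ne; lra.
Qed.

(** The agreement that a distance [c] guarantees, taken maximal so that [c] and q^-m are comparable
    both ways; [0 < m] lets each covering word consume a letter in the word count. *)
Lemma scale_exponent (c : R) : 0 < c < gap / q -> exists m, [/\ (0 < m)%N, c < gap * q ^- m & gap * q ^- m.+1 <= c].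
Proof.
have /andP[q1 qM] := hq.
move=> /andP[c0 cg].
have [n Hn] := small_inv_expr gap q1 c0.
have ex : exists n, gap * q ^- n.+2 <= c by exists n; apply/ltW/Hn; lia.
case: (ex_minnP ex) => m Hm mmin; exists m.+1; split => //.
rewrite ltNge; apply/negP => H; case: m Hm mmin H => [|m] Hm mmin H.
  by move: cg; rewrite expr1 in H; lra.
by have := mmin m H; rewrite ltnn.
Qed.

(** By separation each covering set meets V_q inside one cylinder of length [m i], and finitely many
    suffice. Splitting off the matching first word bounds N(L) by the sum of the N(L - m_i), and
    with the sum of the Q^-m_i at most 1 induction gives N(L) <= Q^(L+D). *)
Lemma snull_Vq_Hent s : 0 < s -> snull s q (Vq M q) -> Hent M q <= s * ln q.
Proof.
have /andP[q1 qM] := hq.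
have q0 : 0 < q by lra.
move=> s0; rewrite (Vq_bounded_by ha) => nV.
have gq0 : 0 < gap / q by rewrite divr_gt0// gap_gt0.
have gs0 : 0 < (gap / q) `^ s by apply: powR_gt0.
(* This total keeps every [c i] below gap/q and, as gap q^-(m+1) <= c, brings the sum of the Q^-m_i
   below 1. *)
have e0 : 0 < (gap / q) `^ s / 2 by rewrite divr_gt0.
have [U [c [EU c0 cU sc]]] := null_pos_cover s0 e0 nV.
have cg i : 0 < c i < gap / q.
  rewrite c0 /=; rewrite ltNge; apply/negP => gc.
  have : (gap / q) `^ s <= c i `^ s by apply: ge0_ler_powR => //; rewrite ?nnegrE ltW.
  have := sum_powR_le s0 (fun i => ltW (c0 i)) sc i; lra.
have /choice[m Hm] : forall i, exists m, [/\ (0 < m)%N, c i < gap * q ^- m & gap * q ^- m.+1 <= c i].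
  by move=> i; exact: scale_exponent.
have /choice[z Hz] : forall i, exists z, forall x, bounded_by M a x -> U i (qval q x) -> agree (m i) x z.
  move=> i; have [[y [Vy Uy]]|H] := pselect (exists y, bounded_by M a y /\ U i (qval q y)).
    exists y => x Vx Ux; have [_ cm _] := Hm i.
    by apply: bounded_agree cm => //; exact: cU.
  by exists (fun=> 0%N) => x Vx Ux; exfalso; apply: H; exists x.
have [|x H|x Vx|N HN] := @finite_subcover M (bounded_by M a) m z.
- by move=> x [].
- exact: bounded_by_closed H.
- have [|i _ Ui] := EU (qval q x); first by exists x.
  by exists i; apply: Hz.
pose Q := q `^ s.
have Q0 : 0 < Q by apply: powR_gt0.
have Qge1 : 1 <= Q.
  have -> : (1 : R) = 1 `^ s by rewrite powR1.
  by apply: ge0_ler_powR; rewrite ?nnegrE ?ltW.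
have QnV k : (q ^- k) `^ s = Q ^- k by exact: powR_exprVn.
have sumQ : \sum_(i < N) Q ^- m i <= 1.
  have le1 i : Q ^- m i <= ((gap / q) `^ s)^-1 * c i `^ s.
    have [_ _ H] := Hm i.
    rewrite mulrC ler_pdivlMr// mulrC -QnV -powRM ?invr_ge0 ?exprn_ge0 ?(ltW q0) ?(ltW gq0)//.
    apply: ge0_ler_powR; rewrite ?nnegrE ?(ltW (c0 _)) ?(ltW s0)//.
      by rewrite mulr_ge0 ?(ltW gq0)// invr_ge0 exprn_ge0// ltW.
    by apply: le_trans H; rewrite exprS invfM mulrA.
  apply: (@le_trans _ _ (\sum_(i < N) ((gap / q) `^ s)^-1 * c i `^ s)).
    by apply: ler_sum.
  rewrite -mulr_sumr ler_pdivrMl// mulr1; have := sc N; lra.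
(* The slack [D] serves lengths L < m_i: the cylinder then contributes a single word, and L + D -
   m_i is still nonnegative. *)
pose D := (\max_(i < N) m i)%N.
have mD i : (i < N)%N -> (m i <= D)%N.
  by move=> iN; exact: (@leq_bigmax _ (fun i : 'I_N => m i) (Ordinal iN)).
have cnt L : (nwords M q L)%:R <= Q ^+ (L + D).
  elim/ltn_ind: L => L IH.
  have /choice[W HW] := words_exist M q.
  pose B i := if (m i <= L)%N then [seq mkseq (z i) (m i) ++ w | w <- W (L - m i)%N]
              else [:: mkseq (z i) L].
  have : (nwords M q L <= size (flatten [seq B i | i <- iota 0 N]))%N.
    apply: nwords_le => x Vx.
    have [i [iN xz]] := HN x (eq_ind _ (fun S : set _ => S x) Vx _ (Vq_bounded_by ha)).
    apply/flattenP; exists (B i); first by apply: map_f; rewrite mem_iota.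
    have mk k : (k <= m i)%N -> mkseq x k = mkseq (z i) k.
      move=> km; apply: (@eq_from_nth _ 0%N); rewrite !size_mkseq// => j jk.
      by rewrite !nth_mkseq// xz// (leq_trans jk).
    rewrite /B; case: leqP => mL; last by rewrite mk ?mem_seq1 ?eqxx// ltnW.
    apply/mapP; exists (mkseq (shift (m i) x) (L - m i)).
      by have [_ _ HWm] := HW (L - m i)%N; apply/HWm; exists (shift (m i) x); split => //; exact: Vq_shift.
    by rewrite -mk// -mkseqD subnKC.
  rewrite -(ler_nat R) => /le_trans; apply.
  rewrite size_flatten /shape -map_comp sumnE big_map natr_sum.
  rewrite -[X in iota 0 X]subn0 -/(index_iota 0 N) big_mkord.
  apply: (@le_trans _ _ (\sum_(i < N) Q ^+ (L + D) * Q ^- m i)); last first.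
    by rewrite -mulr_sumr ler_piMr// exprn_ge0// ltW.
  apply: ler_sum => i _ /=.
  have miD : (m i <= L + D)%N by apply: leq_trans (mD i (ltn_ord i)) (leq_addl _ _).
  rewrite -exprB// ?unitfE ?gt_eqF//.
  rewrite /B; case: leqP => mL; last by rewrite /= exprn_ege1.
  rewrite size_map; have [_ -> _] := HW (L - m i)%N.
  have [m0 _ _] := Hm i.
  have -> : (L + D - m i = L - m i + D)%N by lia.
  by apply: IH; lia.
have lnQ : ln Q = s * ln q by exact: ln_powR.
have lnQ0 : 0 <= ln Q by rewrite ln_ge0.
rewrite -lnQ; apply/ler_addgt0Pr => e ee0.
(* Chosen so that D log Q divided by the length k+1 is at most e. *)
pose k := Num.truncn (D%:R * ln Q / e).
have k0 : (0 : R) < k.+1%:R by rewrite ltr0n.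
have Hk : D%:R * ln Q <= e * k.+1%:R.
  have : D%:R * ln Q / e < k.+1%:R by exact: truncnS_gt.
  by rewrite ltr_pdivrMr// (mulrC e) => /ltW.
apply: le_trans ((@Hent_lim R M q).2 k) _.
rewrite ler_pdivrMr// mulrDl; apply: (@le_trans _ _ (ln (Q ^+ (k.+1 + D)))).
  case: (posnP (nwords M q k.+1)) => [->|np].
    by rewrite ln0// ln_ge0// exprn_ege1.
  by rewrite ler_ln ?posrE ?ltr0n// exprn_gt0.
rewrite lnXn// -[ln Q *+ _]mulr_natr natrD mulrDr; move: Hk; rewrite (mulrC _ (ln Q)); lra.
Qed.

End Furstenberg.

(** * Entropy plateaus *)

Section Plateaus.
Variable R : realType.
Variable M : nat.
Implicit Types (p q r : R) (x : nat -> nat) (n k : nat).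

Definition all_words n : seq (seq nat) :=
  [seq [seq nat_of_ord j | j <- tval w] | w : n.-tuple 'I_M.+1].

Lemma size_all_words n : size (all_words n) = (M.+1 ^ n)%N.
Proof. by rewrite size_map -cardE card_tuple card_ord. Qed.

Lemma mem_all_words x n : digit_seq M x -> mkseq x n \in all_words n.
Proof.
move=> dx; apply/mapP.
pose v : n.-tuple 'I_M.+1 := [tuple inord (x i) | i < n].
exists v; first exact: mem_enum.
apply: (@eq_from_nth _ 0%N); first by rewrite size_mkseq size_map size_tuple.
move=> i; rewrite size_mkseq => ilt.
rewrite nth_mkseq// (nth_map ord0) ?size_tuple//.
have -> : nth ord0 v i = tnth v (Ordinal ilt) by rewrite (tnth_nth ord0).
by rewrite tnth_mktuple inordK// ltnS.
Qed.

Lemma uniq_all_words n : uniq (all_words n).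
Proof.
rewrite map_inj_uniq ?enum_uniq// => w1 w2 /inj_map E.
by apply/val_inj/E; exact: val_inj.
Qed.

Lemma all_words_mkseq n w : w \in all_words n -> exists x, digit_seq M x /\ w = mkseq x n.
Proof.
move=> /mapP[v _ ->]; exists (fun i => nat_of_ord (nth ord0 v i)); split.
  by move=> i; rewrite -ltnS.
apply: (@eq_from_nth _ 0%N); first by rewrite size_mkseq size_map size_tuple.
move=> i; rewrite size_map size_tuple => ilt.
by rewrite nth_mkseq// (nth_map ord0) ?size_tuple.
Qed.

Hypothesis M0 : (0 < M)%N.

Lemma top_base : 1 < (M.+1%:R : R) <= M.+1%:R.
Proof. by rewrite lexx ltr1n ltnS M0. Qed.

Lemma alpha_top : is_alpha M (M.+1%:R : R) (fun=> M).
Proof.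
have /andP[q1 _] := top_base.
have dM : digit_seq M (fun=> M) by move=> i.
split; last first.
  split=> [n|b [db _] _]; first by exists n; split => //; apply/eqP; rewrite -lt0n.
  apply/lex_leNlt => -[n [_]]; apply/negP; rewrite -leqNgt; exact: db.
apply/is_expansionP => //; split => //.
have := qval_shift q1 dM; rewrite (_ : shift 1 (fun=> M) = fun=> M)//.
set v := qval _ _; rewrite -natr1 mulrDl mul1r => H.
have : M%:R * (v - 1) = 0 by move: H; rewrite mulrBr mulr1; lra.
move/eqP; rewrite mulf_eq0 pnatr_eq0 gtn_eqF//= subr_eq0 => /eqP ->.
by [].
Qed.

Lemma Vq_top x : digit_seq M x -> Vq M (M.+1%:R : R) x.
Proof.
move=> dx; rewrite (Vq_bounded_by alpha_top); split => // n; split.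
  apply/lex_leNlt => -[m [_]]; rewrite /reflect_seq subnn; by rewrite ltn0.
apply/lex_leNlt => -[m [_]]; apply/negP; rewrite -leqNgt; exact: dx.
Qed.

Lemma Hent_top : ln (M.+1%:R : R) <= Hent M (M.+1%:R : R).
Proof.
apply: (ler_cvg_to (cvg_cst (ln M.+1%:R)) (@Hent_lim R M M.+1%:R).1).
exists 1%N => // n /= n0.
rewrite ler_pdivlMr ?ltr0n// mulr_natr -lnXn ?ltr0n// -natrX; apply: ln_nat_le.
have [L [uL <- mL]] := words_exist M (M.+1%:R : R) n.
rewrite -(size_all_words n); apply: uniq_leq_size; first exact: uniq_all_words.
move=> w /all_words_mkseq[x [dx ->]]; apply/mL; exists x; split => //; exact: Vq_top.
Qed.

(** With k the first place where alpha(p) has a digit below M, the word M^(k+1) cannot occur in V_p.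
    One missing word at a single length already lowers the entropy, because the entropy is an
    infimum. *)
Lemma Hent_lt_top p : 1 < p < M.+1%:R -> Hent M p < ln M.+1%:R.
Proof.
move=> /andP[p1 pM]; have hp : 1 < p <= M.+1%:R by rewrite p1 ltW.
have [a ha] := alpha_exists hp.
have [|k [ak mk]] := alpha_lt p1 _ ha alpha_top; first by rewrite pM lexx.
have [L [uL sL mL]] := words_exist M p k.+1.
have nL : nseq k.+1 M \notin L.
  apply/negP => /mL[x [Vx E]].
  have [dx _] := Vx.
  have xM i : (i < k.+1)%N -> x i = M.
    by move=> ik; rewrite -(nth_mkseq 0%N x ik) -E nth_nseq ik.
  move: Vx; rewrite (Vq_bounded_by ha) => -[_ /(_ 0%N)[_]].
  rewrite shift0 => /lex_leNlt; apply; exists k; split; last by rewrite xM.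
  by move=> i ik; rewrite ak// xM// ltnS ltnW.
have : (size (nseq k.+1 M :: L) <= size (all_words k.+1))%N.
  apply: uniq_leq_size; first by rewrite /= nL.
  move=> w; rewrite inE => /orP[/eqP ->|/mL[x [[dx _] ->]]]; last exact: mem_all_words.
  have -> : nseq k.+1 M = mkseq (fun=> M) k.+1.
    by apply: (@eq_from_nth _ 0%N); rewrite ?size_mkseq ?size_nseq// => i ik;
      rewrite nth_nseq nth_mkseq// ik.
  by apply: mem_all_words.
rewrite size_all_words /= sL => H.
apply: le_lt_trans ((@Hent_lim R M p).2 k) _.
rewrite ltr_pdivrMr ?ltr0n// mulr_natr -lnXn ?ltr0n// -natrX.
case: (posnP (nwords M p k.+1)) => [->|np].
  by rewrite ln0// ln_gt0// ltr1n -[1%N](exp1n k.+1) ltn_exp2r.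
by rewrite ltr_ln ?posrE ?ltr0n ?expn_gt0// ltr_nat.
Qed.

(** This keeps the components of the complement of the closure away from M+1, so that they have no
    maximum. *)
Lemma Bset_top : @Bset R M M.+1%:R.
Proof.
split; first exact: top_base.
move=> p /andP[p1 pM] pne; rewrite lt_eqF//; apply: lt_le_trans Hent_top.
by apply: Hent_lt_top; rewrite p1 lt_neqAle pne.
Qed.

(** Without a point of B, the interval (p, q) would lie in a component of the complement. That
    component has neither minimum nor maximum, so it is an open interval with right end at least q,
    and q falls into the excluded half-open plateau even if it is the end itself. *)
Lemma Bset_left_dense qKL p q : qKL < p -> p < q <= M.+1%:R ->
  (forall pL pR : R, is_plateau M qKL pL pR -> ~ (pL < q <= pR)) ->
  exists r, p < r < q /\ @Bset R M r.
Proof.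
move=> qKLp /andP[pq qM] noplateau; apply: contrapT => noB.
have Hr r : p < r < q -> ~ @Bset R M r by move=> pr Br; apply: noB; exists r.
set S := [set r | qKL < r <= M.+1%:R] `\` closure (@Bset R M).
have oB : open (~` closure (@Bset R M)) by rewrite openC; exact: closed_closure.
have pqS : `]p, q[ `<=` S.
  move=> r; rewrite /= in_itv /= => /andP[pr rq]; split; first by apply/andP; lra.
  move=> cr; have [|u [Bu]] := cr `]p, q[%classic.
    by apply: open_nbhs_nbhs; split; [exact: interval_open|rewrite /= in_itv /= pr].
  by rewrite /= in_itv /= => /Hr.
pose z := (p + q) / 2.
have zpq : `]p, q[%classic z by rewrite /= in_itv /= /z; lra.
set C := connected_component S z.
have pqC : `]p, q[ `<=` C.
  apply: connected_component_max => //.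
  apply/connected_intervalP; exact: interval_is_interval.
have CS : C `<=` S by exact: connected_component_sub.
have iC : is_interval C by apply/connected_intervalP; exact: component_connected.
have Cz : C z by exact: pqC.
have Cext (x y : R) : C x -> `[Num.min x y, Num.max x y] `<=` S -> C y.
  move=> Cx sub; rewrite /C (same_connected_component Cx).
  have : `[Num.min x y, Num.max x y] `<=` connected_component S x.
    apply: connected_component_max => //.
      by rewrite /= in_itv /= ge_min le_max !lexx.
    apply/connected_intervalP; exact: interval_is_interval.
  apply; by rewrite /= in_itv /= ge_min le_max !lexx !orbT.
have nearB (x : R) : C x -> exists e, 0 < e /\ forall y, `|x - y| < e -> ~ closure (@Bset R M) y.
  move=> /CS[_ nx]; have /nbhs_ballP[e /= e0 He] : nbhs x (~` closure (@Bset R M)).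
    by apply: open_nbhs_nbhs; split.
  by exists e; split => // y xy; exact: (He y).
have Cdown (x : R) : C x -> exists y, C y /\ y < x.
  move=> Cx; have [e [e0 He]] := nearB _ Cx; have [/andP[qx xM] _] := CS _ Cx.
  pose y := Num.max (x - e / 2) ((qKL + x) / 2).
  have yx : y < x by rewrite gt_max; apply/andP; split; lra.
  have ye : x - e / 2 <= y by rewrite le_max lexx.
  have yq : qKL < y by rewrite lt_max; apply/orP; right; lra.
  exists y; split => //; apply: (Cext x) => // r.
  rewrite /= in_itv /= (min_idPr (ltW yx)) (max_idPl (ltW yx)) => /andP[yr rx].
  split; first by apply/andP; lra.
  by apply: He; rewrite ger0_norm; lra.
have Cup (x : R) : C x -> exists y, C y /\ x < y.
  move=> Cx; have [e [e0 He]] := nearB _ Cx; have [/andP[qx xM] nx] := CS _ Cx.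
  have xM' : x < M.+1%:R.
    rewrite lt_neqAle xM andbT; apply/eqP => xE; apply: nx; rewrite xE.
    by apply: subset_closure; exact: Bset_top.
  pose y := Num.min (x + e / 2) ((M.+1%:R + x) / 2).
  have yx : x < y by rewrite lt_min; apply/andP; split; lra.
  have ye : y <= x + e / 2 by rewrite ge_min lexx.
  have yq : y <= M.+1%:R by rewrite ge_min; apply/orP; right; lra.
  exists y; split => //; apply: (Cext x) => // r.
  rewrite /= in_itv /= (min_idPl (ltW yx)) (max_idPr (ltW yx)) => /andP[xr ry].
  split; first by apply/andP; lra.
  by apply: He; rewrite ler0_norm; lra.
have hC : has_lbound C by exists qKL => x /CS[/andP[/ltW]].
have hC' : has_ubound C by exists M.+1%:R => x /CS[/andP[]].
have C0 : C !=set0 by exists z.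
have lez : inf C <= z by apply: ge_inf.
have CE : C = `]inf C, sup C[%classic.
  apply/seteqP; split => x.
    move=> Cx; have [y [Cy yx]] := Cdown _ Cx; have [w [Cw xw]] := Cup _ Cx.
    rewrite /= in_itv /=; apply/andP; split.
      by apply: le_lt_trans yx; apply: ge_inf.
    by apply: lt_le_trans xw _; apply: ub_le_sup.
  rewrite /= in_itv /= => /andP[ix xs].
  have [y Cy yx] := inf_lt C0 ix.
  have [w Cw xw] := sup_gt C0 xs.
  by apply: (iC y w Cy Cw); rewrite (ltW yx) (ltW xw).
have qs : q <= sup C.
  rewrite leNgt; apply/negP => sq.
  have zs : z <= sup C by apply: ub_le_sup.
  pose u := (sup C + q) / 2.
  have : C u by apply: pqC; rewrite /= in_itv /= /u /z in zs *; lra.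
  by move=> /(ub_le_sup hC'); rewrite /u; lra.
apply: (noplateau (inf C) (sup C)); last first.
  by rewrite qs andbT; apply: le_lt_trans lez _; rewrite /z; lra.
split; last by exists z.
by apply: le_lt_trans lez _; apply: lt_le_trans qs; rewrite /z; lra.
Qed.

Lemma Hent_lt_left qKL q : 1 < qKL -> qKL < q <= M.+1%:R ->
  (forall pL pR : R, is_plateau M qKL pL pR -> ~ (pL < q <= pR)) ->
  forall p, 1 < p < q -> Hent M p < Hent M q.
Proof.
move=> qKL1 /andP[qKLq qM] noplateau p /andP[p1 pq].
(* The midpoint in the maximum puts the lower end above [qKL] even when p is below it. *)
have [r [/andP[pr rq] [_ /(_ q)]]] : exists r, Num.max p ((qKL + q) / 2) < r < q /\ @Bset R M r.
  apply: Bset_left_dense noplateau; first by rewrite lt_max; apply/orP; right; lra.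
  by rewrite gt_max pq qM !andbT /=; lra.
have pr' : p < r by apply: le_lt_trans pr; rewrite le_max lexx.
have h1 : 1 < q <= M.+1%:R by lra.
have h2 : p <= r <= M.+1%:R by lra.
have h3 : 1 < r by lra.
have h4 : r <= q <= M.+1%:R by lra.
move=> /(_ h1); rewrite gt_eqF// => /(_ isT) ne.
apply: le_lt_trans (Hent_mono p1 h2) _.
by rewrite lt_neqAle eq_sym ne Hent_mono.
Qed.

End Plateaus.

(** * Grafting *)

Section LocalNull.
Variable R : realType.
Variable M : nat.
Variables (q : R) (a : nat -> nat).
Hypotheses (hq : 1 < q <= M.+1%:R) (ha : is_alpha M q a).
Implicit Types (x y c : nat -> nat) (n m i k : nat) (s r d : R) (P : set (nat -> nat)).

(** Stripping a fixed prefix is affine, so nullity of [P] can be tested on the grafted sequences;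
    those in [alpha_ended] are null anyway. *)
Lemma snull_of_local s r d x k P : 0 < s -> digit_seq M x -> P `<=` digit_seq M ->
  null s (Uq M q `&` `]r - d, r + d[) ->
  (forall c, P c -> ~ alpha_ended M a (wcat (mkseq x k) c) ->
     univoque_cond M q (wcat (mkseq x k) c) /\ `|qval q (wcat (mkseq x k) c) - r| < d) ->
  snull s q P.
Proof.
move=> s0 dx dP nU H; have /andP[q1 _] := hq.
apply: (@snull_prefix R M s q (mkseq x k)) => //.
  by move=> c Pc; apply: digit_wcat => //; exact: dP.
pose E b := if b then Uq M q `&` `]r - d, r + d[%classic else [set qval q y | y in alpha_ended M a].
have nE : forall b : bool, null s (E b) by case => //; exact: snull_alpha_ended.
apply: null_sub (null_bigcup s0 nE) => _ [c Pc <-].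
have [en|nen] := pselect (alpha_ended M a (wcat (mkseq x k) c)).
  by exists false => //; exists (wcat (mkseq x k) c).
have [uc close] := H c Pc nen; exists true => //; split.
  by apply: Uq_intro => //; apply: digit_wcat => //; exact: dP.
by move: close; rewrite ltr_norml /= in_itv /=; lra.
Qed.

Lemma alpha_ended_shift n y : digit_seq M y -> alpha_ended M a (shift n y) -> alpha_ended M a y.
Proof.
by move=> dy [_ [k H]]; split => //; exists (n + k)%N; rewrite -shift_shift.
Qed.

Lemma qval_near d x : digit_seq M x -> 0 < d -> exists n, forall m y, (n <= m)%N -> digit_seq M y ->
  agree m y x -> `|qval q y - qval q x| < d.
Proof.
move=> dx d0; have /andP[q1 _] := hq.
have [n Hn] := small_inv_expr (M%:R / (q - 1)) q1 d0.
exists n => m y nm dy yx; apply: le_lt_trans (qval_close q1 dy dx yx) _; exact: Hn.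
Qed.

(** Near the endpoint 0 a block of zeros is grafted before a sequence of V_q: a zero cannot be
    lowered, and each one divides the value of the tail by q, so the bound 1 survives. *)
Lemma snull_local0 s d : 0 < s -> 0 < d -> null s (Uq M q `&` `]0 - d, 0 + d[) ->
  snull s q (bounded_by M a).
Proof.
move=> s0 d0 nU; have /andP[q1 _] := hq; have q0 : 0 < q by lra.
pose z (i : nat) := 0%N; have dz : digit_seq M z by [].
have [n Hn] := @qval_near d z dz d0.
apply: (snull_of_local (x := z) (k := n) s0 dz _ nU); first by move=> x [].
move=> c Vc; set y := wcat _ _ => nen.
have dy : digit_seq M y by apply: digit_wcat => //; case: Vc.
have yc j : shift (n + j) y = shift j c by rewrite -shift_shift /y shift_wcat_mkseq.
have tail j : qval q (shift (n + j) y) < 1 /\ qval q (reflect_seq M (shift (n + j) y)) < 1.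
  rewrite yc; have := @bounded_tail_lt1 _ _ _ _ hq ha (shift j c) 0 (bounded_by_shift j Vc).
  rewrite shift0; apply => en; apply: nen; rewrite -yc in en.
  exact: alpha_ended_shift en.
have y0 i : (i < n)%N -> y i = 0%N by move=> ilt; rewrite /y wcat_mkseq_agree.
have head k i : (i + k)%N = n -> qval q (shift i y) < 1.
  elim: k i => [|k IH] i; first by rewrite addn0 => ->; have [] := tail 0%N; rewrite addn0.
  move=> ik; rewrite (qval_cons q1 (digit_shift i dy)) shift_shift /shift addn0 y0; last by lia.
  rewrite add0r ltr_pdivrMr// mul1r; apply: lt_trans q1.
  by apply: IH; lia.
split.
  split => i hi.
    have [ni|ni] := leqP n i.+1; last by apply: (head (n - i.+1)%N); lia.
    by have [] := tail (i.+1 - n)%N; rewrite subnKC.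
  have [ni|ni] := leqP n i; last by rewrite y0 in hi.
  by have [] := tail (i.+1 - n)%N; rewrite subnKC//; lia.
have := Hn n y (leqnn n) dy (@wcat_mkseq_agree z c n).
by rewrite (@qval_eq0 _ _ _ z q1 dz).
Qed.

Lemma Uq_reflect r : Uq M q r -> Uq M q (M%:R / (q - 1) - r).
Proof.
have /andP[q1 _] := hq => /(Uq_elim hq)[x [dx -> ux]].
rewrite -(qval_reflect q1 dx); apply: Uq_intro => //; first exact: digit_reflect.
exact: univoque_cond_reflect.
Qed.

Lemma null_local_reflect s r d : 0 < s -> null s (Uq M q `&` `]r - d, r + d[) ->
  null s (Uq M q `&` `]M%:R / (q - 1) - r - d, M%:R / (q - 1) - r + d[).
Proof.
move=> s0 nU; apply: null_sub (null_affine (-1) (M%:R / (q - 1)) s0 nU).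
move=> u [Uu]; rewrite /= in_itv /= => hu; exists (M%:R / (q - 1) - u); last by ring.
split; first exact: Uq_reflect.
by rewrite /= in_itv /=; lra.
Qed.

(** The univoque conditions are strict, hence stable under small changes; this is applied at the
    finitely many places before the tail enters V_q. *)
Lemma local_threshold x i : digit_seq M x -> univoque_cond M q x ->
  exists n, forall m y, (n <= m)%N -> digit_seq M y -> agree m y x ->
    ((x i < M)%N -> qval q (shift i.+1 y) < 1) /\
    ((0 < x i)%N -> qval q (reflect_seq M (shift i.+1 y)) < 1).
Proof.
move=> dx [H1 H2].
have A z : digit_seq M z -> qval q z < 1 -> exists n, forall m y, (n <= m)%N ->
    digit_seq M y -> agree m y z -> qval q y < 1.
  move=> dz z1; have [|n Hn] := @qval_near (1 - qval q z) z dz; first by rewrite subr_gt0.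
  exists n => m y nm dy yz; have := Hn m y nm dy yz.
  by rewrite ltr_norml; lra.
have [n1 N1] : exists n, forall m y, (n <= m)%N -> digit_seq M y -> agree m y (shift i.+1 x) ->
    (x i < M)%N -> qval q y < 1.
  have [lt|ge] := boolP (x i < M)%N; last by exists 0%N.
  by have [n Hn] := A _ (digit_shift _ dx) (H1 i lt); exists n => m y h1 h2 h3 _; exact: Hn h3.
have [n2 N2] : exists n, forall m y, (n <= m)%N -> digit_seq M y ->
    agree m y (reflect_seq M (shift i.+1 x)) -> (0 < x i)%N -> qval q y < 1.
  have [lt|ge] := boolP (0 < x i)%N; last by exists 0%N.
  by have [n Hn] := A _ (digit_reflect _ _) (H2 i lt); exists n => m y h1 h2 h3 _; exact: Hn h3.
exists (i.+1 + maxn n1 n2)%N => m y nm dy yx.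
have ag : agree (m - i.+1) (shift i.+1 y) (shift i.+1 x).
  by apply: agree_shift; rewrite subnKC//; lia.
split => h.
  apply: (N1 (m - i.+1)%N) => //; [by lia|exact: digit_shift].
apply: (N2 (m - i.+1)%N) => //; [by lia|exact: digit_reflect|].
by move=> j jm; rewrite /reflect_seq ag.
Qed.

End LocalNull.

Lemma exponent_between (R : realType) (h1 h2 l : R) : 0 <= h1 -> h1 < h2 -> 0 < l ->
  exists t, [/\ 0 < t, h1 < t * l & t * l < h2].
Proof.
move=> h10 h12 l0; exists ((h1 + h2) / 2 / l); rewrite divfK ?gt_eqF//.
by split; [rewrite !divr_gt0//; lra|lra|lra].
Qed.

Section Graft.
Variable R : realType.
Variable M : nat.
Variables (q : R) (a : nat -> nat).
Hypotheses (hq : 1 < q < M.+1%:R) (ha : is_alpha M q a).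
Hypothesis hH : forall p, 1 < p < q -> Hent M p < Hent M q.
Implicit Types (x y c : nat -> nat) (n m i j k r : nat) (s t : R).

Let V := bounded_by M a.

Let hq' := base_range hq.

Definition avoiding n : set (nat -> nat) :=
  [set x | V x /\ forall k, ~ agree n (shift k x) a /\ ~ agree n (reflect_seq M (shift k x)) a].

Definition following n : set (nat -> nat) := [set x | V x /\ agree n x a].

(** The exponent lies strictly between H(p)/log q and H(q)/log q, with p so close to q that alpha(p)
    and alpha(q) share n digits. *)
Lemma avoiding_snull n : exists t, [/\ 0 < t, snull t q (avoiding n) & ~ snull t q V].
Proof.
have /andP[q1 qM] := hq; have da := alpha_digit ha.
have [p [/andP[p1 pq] ab]] := alpha_left_approx n hq' ha.
have hp : 1 < p <= M.+1%:R by lra.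
have [b hb] := alpha_exists hp; have db := alpha_digit hb.
have Ab : avoiding n `<=` Vq M p.
  move=> x [[dx Vx] H]; rewrite (Vq_bounded_by hb); split => // k.
  (* A sequence that drops below [a] within n digits is below every sequence with that prefix, in
     particular below [b]. *)
  have up y : digit_seq M y -> lex_le y a -> ~ agree n y a -> lex_le y b.
    move=> dy ya nya; have [i [ilt agi lti]] := lex_prefix_lt ya nya.
    by apply/lex_ltW/(lex_lt_agree agi lti ilt) => //; exact: ab.
  have [lo hi] := Vx k; have [n1 n2] := H k; split; last by apply: up => //; exact: digit_shift.
  rewrite -(reflectK (digit_shift k dx)); apply: lex_le_reflect => //.
  apply: up n2; first exact: digit_reflect.
  by rewrite -(reflectK da); apply: lex_le_reflect lo; exact: digit_shift.
have lnq : 0 < ln q by rewrite ln_gt0.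
have Hpq : Hent M p < Hent M q by apply: hH; rewrite p1.
have [t [t0 pt tq]] := exponent_between (Hent_ge0 M p) Hpq lnq.
exists t; split => //; first by apply: snull_sub Ab _; exact: snull_entropy.
rewrite /V -(Vq_bounded_by ha) => /(snull_Vq_Hent hq ha t0).
by rewrite leNgt tq.
Qed.

(* Sequences avoiding a prefix of alpha have too small an entropy to carry the dimension of V. *)
Lemma snull_of_following s n : 0 < s -> snull s q (following n) -> snull s q V.
Proof.
move=> s0 nF; have /andP[q1 qM] := hq.
have [t [t0 nA nV]] := avoiding_snull n.
pose m := Num.max s t.
have m0 : 0 < m by rewrite lt_max s0.
have nFm : snull m q (following n) by apply: snull_le nF => //; rewrite le_max lexx.
have nAm : snull m q (avoiding n) by apply: snull_le nA => //; rewrite le_max lexx orbT.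
have dF : following n `<=` digit_seq M by move=> x [[]].
have nVm : snull m q V.
  apply: snull_sub (snullU m0 nAm (@snull_eventually _ M _ _ _ m0 q1
    (snullU m0 nFm (snull_reflect m0 q1 dF nFm)))).
  move=> x Vx; have dx : digit_seq M x by case: Vx.
  have [[k Hk]|H] := pselect (exists k, agree n (shift k x) a \/ agree n (reflect_seq M (shift k x)) a).
    right; split => //; exists k; case: Hk => Hk; [left|right].
      by split => //; exact: bounded_by_shift.
    exists (reflect_seq M (shift k x)); last by rewrite reflectK//; exact: digit_shift.
    split => //; apply: bounded_by_reflect; first exact: alpha_digit ha.
    exact: bounded_by_shift.
  by left; split => // k; split => h; apply: H; exists k; [left|right].
move: nVm; rewrite /m; case: (leP s t) => // _; by move/nV.
Qed.

Lemma reflect_shift_lt r : lex_lt (shift r (reflect_seq M a)) a.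
Proof.
have /andP[q1 qM] := hq; have da := alpha_digit ha.
case: (lex_total (shift r (reflect_seq M a)) a) => [E|[//|[k [ak lt]]]]; exfalso.
  have [t [t0 _ nV]] := avoiding_snull 0.
  apply/nV/(@snull_of_following t r t0).
  (* Here the shift by r of [a] is the reflection of [a], so the upper and lower bounds on the tail
     of [x] coincide and [x] ends in that reflection. *)
  apply: snull_sub (snull_alpha_ended a hq' t0).
  move=> x [[dx Vx] ax]; split => //; exists r; right.
  apply: lex_le_anti; last by case: (Vx r).
  have -> : reflect_seq M a = shift r a.
    by rewrite -[in LHS]E reflect_shift reflectK.
  apply: lex_le_shift => //; by have [_] := Vx 0%N; rewrite shift0.
(* An excess at index k is inherited by every [x] that follows [a] for r+k+1 digits, against the
   bound on its reflected tails: no such [x] exists. *)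
have [t [t0 _ nV]] := avoiding_snull 0.
apply/nV/(@snull_of_following t (r + k.+1) t0).
apply: snull_sub (snull1 q a t0) => x [[dx Vx] ax]; exfalso.
have [lo _] := Vx r.
have : lex_le (reflect_seq M (shift r x)) a.
  by rewrite -(reflectK da); apply: lex_le_reflect lo; exact: digit_shift.
move/lex_leNlt; apply; apply: (lex_lt_agree ak lt (ltnSn k)) => // i ik.
by rewrite /shift /reflect_seq ax// ltn_add2l.
Qed.

(* Cutting x at the start of its longest suffix within [0, n) that is a prefix of alpha, and continuing with a sequence that follows alpha for long enough, stays in V: the match in progress is only prolonged, and reflect_shift_lt makes the lower bound strict. *)
Lemma graft x n : V x -> exists m N, [/\ (m <= n)%N,
  forall c, following N c -> agree n (wcat (mkseq x m) c) x &
  forall c, following N c -> V (wcat (mkseq x m) c)].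
Proof.
move=> [dx Vx]; have da := alpha_digit ha.
have ex : exists m, `[< (m <= n)%N /\ agree (n - m) (shift m x) a >].
  by exists n; apply/asboolP; rewrite subnn.
case: (ex_minnP ex) => m /asboolP[mn xa] mmin.
have /choice[K HK] : forall r, exists k, agree k (shift r (reflect_seq M a)) a /\
    (shift r (reflect_seq M a) k < a k)%N by exact: reflect_shift_lt.
(* At least n digits of [a] preserve the original prefix, and K r + 1 of them exhibit the strict
   inequality at every offset r <= n. *)
pose N := maxn n (\max_(r < n.+1) (K r).+1).
have KN r : (r <= n)%N -> (K r < N)%N.
  move=> rn; rewrite /N leq_max; apply/orP; right.
  by apply: leq_trans (@leq_bigmax _ (fun r : 'I_n.+1 => (K r).+1) (Ordinal (rn : r < n.+1)%N)).
have nN : (n <= N)%N by rewrite leq_maxl.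
have yx c : following N c -> agree n (wcat (mkseq x m) c) x.
  move=> [_ ca] i ilt; have [im|mi] := ltnP i m; first by rewrite wcat_mkseq_agree.
  rewrite /wcat size_mkseq ltnNge mi /= ca; last by lia.
  by rewrite -xa; [rewrite /shift subnKC|lia].
exists m, N; split => // c Fc; have Vc : V c by case: Fc.
have ca : agree N c a by case: Fc.
set y := wcat _ _.
have dy : digit_seq M y by apply: digit_wcat => //; case: Vc.
have yc : shift m y = c by exact: shift_wcat_mkseq.
split => // j; have [mj|jm] := leqP m j.
  have -> : shift j y = shift (j - m) c by rewrite -yc shift_shift subnKC.
  by case: Vc => _; apply.
have agj : agree (n - j) (shift j x) (shift j y).
  by apply/agree_sym/agree_shift; rewrite subnKC; [exact: yx|lia].
have [lo hi] := Vx j; split; last first.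
  have nag : ~ agree (n - j) (shift j x) a.
    move=> ag; have : (m <= j)%N by apply: mmin; apply/asboolP; split => //; lia.
    by lia.
  have [i [ilt agi lti]] := lex_prefix_lt hi nag.
  exact/lex_ltW/(lex_lt_agree agi lti ilt agj).
have [ag|nag] := pselect (agree (n - j) (reflect_seq M a) (shift j x)); last first.
  have [i [ilt agi lti]] := lex_prefix_lt lo nag.
  by apply/lex_ltW/(lex_lt_agree agi lti ilt).
(* Up to the cut the window agrees with the reflection of [a]; past it, that reflection shifted by m
   - j is compared with the start of [a]. *)
have rj : (m - j <= n - j)%N by lia.
apply: (@lex_le_unshift (m - j)).
  exact: agree_le rj (agree_trans ag agj).
rewrite shift_shift subnKC ?(ltnW jm)// yc.
have [agk ltk] := HK (m - j)%N.
apply/lex_ltW/(lex_lt_agree agk ltk (KN _ _)) => //; first by lia.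
exact: agree_sym.
Qed.

(** The constant sequences are settled at 0 and by reflection. Otherwise the tail from some k on
    lies in V_q: the graft is made there, far enough out that the first k digits keep their
    conditions. *)
Lemma snull_local s (r d : R) : 0 < s -> 0 < d -> Uq M q r ->
  null s (Uq M q `&` `]r - d, r + d[) -> snull s q V.
Proof.
move=> s0 d0 Ur nU; have /andP[q1 qM] := hq.
have [x [dx rx ux]] := Uq_elim hq' Ur.
case: (univoque_cases hq' ha dx ux) => [x0|xM|[k sx]].
- apply: (snull_local0 hq' ha s0 d0); move: nU.
  by rewrite rx (@qval_eq0 _ _ _ x q1 dx)// => i; rewrite x0.
- apply: (snull_local0 hq' ha s0 d0); have := null_local_reflect hq' s0 nU.
  rewrite rx -(qval_reflect q1 dx) (@qval_eq0 _ M _ (reflect_seq M x) q1)//; first exact: digit_reflect.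
  by move=> i; rewrite xM /reflect_seq subnn.
have Vx : V (shift k x) by apply: (strict_tails_bounded ha) => //; exact: digit_shift.
have /choice[T HT] : forall i, _ := fun i => local_threshold hq' i dx ux.
have [n0 Hn0] := qval_near hq' dx d0.
pose n := maxn n0 (\max_(i < k) T i).
have Tn i : (i < k)%N -> (T i <= n)%N.
  move=> ik; rewrite /n leq_max; apply/orP; right.
  exact: (@leq_bigmax _ (fun i : 'I_k => T i) (Ordinal ik)).
have n0n : (n0 <= n)%N by rewrite leq_maxl.
have [m [N [mn agx Vy]]] := graft n Vx.
apply: (@snull_of_following s N) => //.
apply: (@snull_of_local R M q a hq' s r d x (k + m)%N _ s0 dx _ nU); first by move=> c [[]].
move=> c Fc; set y := wcat _ _ => nen.
have dy : digit_seq M y by apply: digit_wcat => //; case: Fc => -[].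
have yk : shift k y = wcat (mkseq (shift k x) m) c.
  apply/funext => i; rewrite /shift /y /wcat !size_mkseq ltn_add2l subnDl.
  by case: ltnP => // im; rewrite !nth_mkseq ?ltn_add2l.
have yx : agree (k + n) y x.
  move=> i ilt; have [ik|ki] := ltnP i k.
    by rewrite /y wcat_mkseq_agree// ltn_addr.
  have := agx c Fc (i - k)%N; rewrite -yk /shift subnKC// => -> //; lia.
have Vk : V (shift k y) by rewrite yk; exact: Vy.
have nek : ~ alpha_ended M a (shift k y) by move=> /(alpha_ended_shift dy).
split; last by rewrite rx; apply: (Hn0 (k + n)%N) => //; lia.
have tail i : (k <= i)%N -> qval q (shift i y) < 1 /\ qval q (reflect_seq M (shift i y)) < 1.
  move=> ki; have := bounded_tail_lt1 hq' ha (i - k) Vk nek.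
  by rewrite shift_shift subnKC.
split => i hi; (have [ki|ik] := leqP k i; first by case: (tail i.+1 (leqW ki))).
  have [h _] := HT i (k + n)%N y (leq_trans (Tn i ik) (leq_addl _ _)) dy yx.
  by apply: h; rewrite -yx// ltn_addr.
have [_ h] := HT i (k + n)%N y (leq_trans (Tn i ik) (leq_addl _ _)) dy yx.
by apply: h; rewrite -yx// ltn_addr.
Qed.

End Graft.

(** * Bases up to the Komornik-Loreti constant *)

Section ThueMorse.
Implicit Types (n i j f g : nat).

Lemma tm_aux_fuel f g n : (n <= f)%N -> (n <= g)%N -> tm_aux f n = tm_aux g n.
Proof.
elim: f g n => [|f IH] [|g] [|n] //= nf ng; congr (1 - _)%N; apply: IH.
  by have := expn_gt0 2 (trunc_log 2 n.+1); lia.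
by have := expn_gt0 2 (trunc_log 2 n.+1); lia.
Qed.

Lemma tau_double n j : (j < 2 ^ n)%N -> tau (2 ^ n + j) = (1 - tau j)%N.
Proof.
move=> jn; have p0 : (0 < 2 ^ n)%N by rewrite expn_gt0.
have tl : trunc_log 2 (2 ^ n + j) = n.
  by apply: trunc_log_eq => //; rewrite leq_addr expnS mul2n -addnn ltn_add2l.
rewrite /tau; case E: (2 ^ n + j)%N => [|m]; first by lia.
rewrite /= -E tl addKn; congr (1 - _)%N; apply: tm_aux_fuel => //; lia.
Qed.

Lemma tau_le1 n : (tau n <= 1)%N.
Proof. by rewrite /tau; case: n => //= n; exact: leq_subr. Qed.

Lemma tau_pow2 n : tau (2 ^ n) = 1%N.
Proof. by rewrite -[X in tau X]addn0 tau_double// expn_gt0. Qed.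

Variable M : nat.
Hypothesis M0 : (0 < M)%N.

(** Index i holds lambda_(i+1), so plain reflection stops one short of the block end; at that last
    place, in [lamKL_last], the reflected digit is raised by one. *)
Lemma lamKL_double n i : (i.+1 < 2 ^ n)%N -> lamKL M (2 ^ n + i) = (M - lamKL M i)%N.
Proof.
move=> lt; rewrite /lamKL -addnS !tau_double//; last by lia.
have := tau_le1 i; have := tau_le1 i.+1.
have := odd_double_half M; case: odd; rewrite -addnn; lia.
Qed.

Lemma lamKL_last n : lamKL M (2 ^ n + (2 ^ n).-1) = (M - lamKL M (2 ^ n).-1).+1.
Proof.
have p0 : (0 < 2 ^ n)%N by rewrite expn_gt0.
rewrite /lamKL -addnS prednK// addnn -mul2n -expnS !tau_pow2 tau_double; last by lia.
have := tau_le1 (2 ^ n).-1.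
have := odd_double_half M; case: odd; rewrite -addnn; lia.
Qed.

Lemma lamKL0 : lamKL M 0 = (M./2).+1.
Proof. by rewrite /lamKL; case: odd; rewrite /tau /= ?subn0 addn1. Qed.

End ThueMorse.

Section KomornikLoreti.
Variable R : realType.
Variable M : nat.
Hypothesis M0 : (0 < M)%N.
Let lam := lamKL M.
Hypothesis dlam : digit_seq M lam.
Implicit Types (q s : R) (x c : nat -> nat) (n i j k t : nat) (w : seq nat).

Definition following_lam t : set (nat -> nat) := [set c | bounded_by M lam c /\ agree t c lam].

Lemma lex_le_digit n x y : lex_le x y -> agree n x y -> (x n <= y n)%N.
Proof.
move=> xy ag; rewrite leqNgt; apply/negP => yx.
by move/lex_leNlt: xy; apply; exists n; split => //; exact: agree_sym.
Qed.

Lemma agreeS n x y : agree n x y -> x n = y n -> agree n.+1 x y.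
Proof. by move=> ag e i; rewrite ltnS leq_eqVlt => /orP[/eqP ->|/ag]. Qed.

Lemma agreeD n m x y : agree n x y -> agree m (shift n x) (shift n y) -> agree (n + m) x y.
Proof.
move=> ag agm i ilt; have [/ag//|ni] := ltnP i n.
by have := agm (i - n)%N; rewrite /shift subnKC// => -> //; lia.
Qed.

Lemma agree_reflect n x y : agree n x y -> agree n (reflect_seq M x) (reflect_seq M y).
Proof. by move=> ag i /ag; rewrite /reflect_seq => ->. Qed.

(* With T the prefix of lambda of length t = 2^n, a block T is followed either by its reflection or by the block that completes it to the prefix of length 2t, which is then followed by the reflection of T. *)
Lemma following_lam_step n c : following_lam (2 ^ n) c ->
  following_lam (2 ^ n) (reflect_seq M (shift (2 ^ n) c)) \/
  following_lam (2 ^ n.+1) c /\ following_lam (2 ^ n) (reflect_seq M (shift (2 ^ n.+1) c)).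
Proof.
move=> [Vc cl]; set t := (2 ^ n)%N in cl *.
have t0 : (0 < t)%N by rewrite expn_gt0.
have dc : digit_seq M c by case: Vc.
have fl k : agree t (reflect_seq M lam) (shift k c) -> following_lam t (reflect_seq M (shift k c)).
  move=> ag; split; first by apply/bounded_by_reflect/bounded_by_shift.
  by rewrite -(reflectK dlam); apply/agree_sym/agree_reflect.
have [lo _] : lex_le (reflect_seq M lam) (shift t c) /\ lex_le (shift t c) lam by case: Vc => _; exact.
have hi : lex_le (shift t c) (shift t lam).
  by apply: lex_le_shift => //; case: Vc => _ /(_ 0%N)[]; rewrite shift0.
have rl : agree t.-1 (reflect_seq M lam) (shift t lam).
  by move=> i it; rewrite /shift /lam lamKL_double// -/t; lia.
have ag1 := lex_squeeze lo hi rl.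
have lo1 := lex_le_digit lo ag1.
have hi1 : (shift t c t.-1 <= shift t lam t.-1)%N.
  by apply: (lex_le_digit hi); apply: agree_trans (agree_sym ag1) rl.
have last : shift t lam t.-1 = (reflect_seq M lam t.-1).+1 by exact: lamKL_last.
move: hi1; rewrite last leq_eqVlt => /orP[/eqP E|]; last first.
  rewrite ltnS => hi1; left; apply: fl.
  have E : reflect_seq M lam t.-1 = shift t c t.-1 by apply/eqP; rewrite eqn_leq lo1.
  by have := agreeS ag1 E; rewrite prednK.
have t2 : (2 ^ n.+1)%N = (t + t)%N by rewrite expnS mul2n addnn.
have ag2 : agree (2 ^ n.+1) c lam.
  rewrite t2; apply: agreeD => //.
  have E' : shift t c t.-1 = shift t lam t.-1 by rewrite E last.
  by have := agreeS (agree_trans (agree_sym ag1) rl) E'; rewrite prednK.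
right; split => //; apply: fl.
have [lo2 _] : lex_le (reflect_seq M lam) (shift (2 ^ n.+1) c) /\ lex_le (shift (2 ^ n.+1) c) lam.
  by case: Vc => _; exact.
have hi2 : lex_le (shift (2 ^ n.+1) c) (shift (2 ^ n.+1) lam).
  by apply: lex_le_shift => //; case: Vc => _ /(_ 0%N)[]; rewrite shift0.
apply: lex_squeeze lo2 hi2 _ => i it.
by rewrite /shift /lam lamKL_double// t2; lia.
Qed.

(** Either choice fills at least 2^n places and leaves the reflection of a sequence of the same
    kind, so j steps need 2^j words. *)
Lemma following_lam_words n j : exists W : seq (seq nat), size W = (2 ^ j)%N /\
  forall c, following_lam (2 ^ n) c ->
    exists w, [/\ w \in W, (j * 2 ^ n <= size w)%N & agree (size w) c (nth 0%N w)].
Proof.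
elim: j => [|j [W [sW HW]]].
  by exists [:: [::]]; split => // c _; exists [::]; rewrite mem_head.
pose ext t w := mkseq lam t ++ [seq (M - d)%N | d <- w].
exists ([seq ext (2 ^ n)%N w | w <- W] ++ [seq ext (2 ^ n.+1)%N w | w <- W]); split.
  by rewrite size_cat !size_map sW expnS mul2n addnn.
have key t c w : digit_seq M c -> agree t c lam ->
    agree (size w) (reflect_seq M (shift t c)) (nth 0%N w) ->
    agree (size (ext t w)) c (nth 0%N (ext t w)).
  move=> dc cl cw i; rewrite size_cat size_mkseq size_map => ilt.
  rewrite nth_cat size_mkseq; case: ltnP => it; first by rewrite nth_mkseq// cl.
  have iw : (i - t < size w)%N by rewrite ltn_subLR.
  rewrite (nth_map 0%N)// -cw// /reflect_seq /shift subnKC// subKn//; exact: dc.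
move=> c Fc; have [[dc _] cl] := Fc.
case: (following_lam_step Fc) => [/HW[w [wW sw cw]]|[[_ cl2] /HW[w [wW sw cw]]]].
  exists (ext (2 ^ n)%N w); split; last exact: key.
    by rewrite mem_cat map_f.
  by rewrite size_cat size_mkseq size_map mulSn leq_add2l.
exists (ext (2 ^ n.+1)%N w); split; last exact: key.
  by rewrite mem_cat map_f ?orbT.
by rewrite size_cat size_mkseq size_map mulSn leq_add// leq_exp2l.
Qed.

Lemma following_lam_digit t : following_lam t `<=` digit_seq M.
Proof. by move=> c [[]]. Qed.

(** The cover costs a constant times (2 / Q^(2^n))^j, which tends to 0 in j. *)
Lemma snull_following_lam q s n : 0 < s -> 1 < q -> 2 < (q `^ s) ^+ (2 ^ n) ->
  snull s q (following_lam (2 ^ n)).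
Proof.
move=> s0 q1; set Q := q `^ s => Q2; have q0 : 0 < q by lra.
have Q0 : 0 < Q by exact: powR_gt0.
have K0 : 0 <= M%:R / (q - 1) by rewrite divr_ge0//; lra.
apply: (@snull_word_cover R M) => //; first exact: following_lam_digit.
move=> e e0.
have b1 : 1 < Q ^+ (2 ^ n) / 2 by rewrite ltr_pdivlMr// mul1r.
have [j Hj] := small_inv_expr ((M%:R / (q - 1)) `^ s) b1 e0.
have [W [sW HW]] := following_lam_words n j.
exists (j * 2 ^ n)%N, W; split => //; rewrite sW.
apply: le_trans (ltW (Hj j (leqnn j))).
rewrite powRM// ?invr_ge0 ?exprn_ge0 ?(ltW q0)// powR_exprVn// -/Q.
by rewrite natrX expr_div_n invf_div mulnC exprM mulrCA.
Qed.

(** A sequence in which neither the longer prefix nor its reflection ever appears has no choice in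
    [following_lam_step]: it alternates one block with its reflection. Apart from it, every sequence
    eventually reaches the null set of the next level. *)
Lemma snull_bounded_step q s n : 0 < s -> 1 < q -> snull s q (following_lam (2 ^ n.+1)) ->
  snull s q (following_lam (2 ^ n)).
Proof.
move=> s0 q1 nF; set t := (2 ^ n)%N; have t0 : (0 < t)%N by rewrite expn_gt0.
pose never c := following_lam t c /\ forall k, ~ following_lam (2 ^ n.+1) (shift k c) /\
   ~ following_lam (2 ^ n.+1) (reflect_seq M (shift k c)).
have neverS c : never c -> never (reflect_seq M (shift t c)).
  move=> [Fc H]; have dc := following_lam_digit Fc.
  case: (following_lam_step Fc) => [F'|[F' _]]; last by have [] := H 0%N; rewrite shift0.
  split => // k; have [h1 h2] := H (t + k)%N; rewrite -reflect_shift shift_shift; split => //.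
  by rewrite reflectK//; exact: digit_shift.
have uniq k c d : never c -> never d -> agree (k * t) c d.
  elim: k c d => [|k IH] c d Nc Nd //.
  have [dc dd] : digit_seq M c /\ digit_seq M d.
    by split; [case: Nc|case: Nd] => /following_lam_digit.
  rewrite mulSn; apply: agreeD.
    by case: Nc Nd => -[_ cl] _ [[_ dl] _]; exact: agree_trans cl (agree_sym dl).
  have := agree_reflect (IH _ _ (neverS _ Nc) (neverS _ Nd)).
  by rewrite !reflectK//; exact: digit_shift.
have nN : snull s q never.
  have [[c Nc]|none] := pselect (exists c, never c); last first.
    by apply: snull_sub (snull1 q lam s0) => c Nc; exfalso; apply: none; exists c.
  apply: snull_sub (snull1 q c s0) => d Nd; apply/funext => i.
  by apply: (uniq i.+1 d c) => //; rewrite (leq_trans (ltnSn i))// leq_pmulr.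
apply: snull_sub (snullU s0 nN (@snull_eventually _ M _ _ _ s0 q1
   (snullU s0 nF (snull_reflect s0 q1 (@following_lam_digit _) nF)))) => c Fc.
have dc := following_lam_digit Fc.
have [[k Hk]|H] := pselect (exists k, following_lam (2 ^ n.+1) (shift k c) \/
   following_lam (2 ^ n.+1) (reflect_seq M (shift k c))).
  right; split => //; exists k; case: Hk => Hk; [by left|right].
  by exists (reflect_seq M (shift k c)) => //; rewrite reflectK//; exact: digit_shift.
by left; split => // k; split => h; apply: H; exists k; [left|right].
Qed.

Lemma snull_bounded_by_lam q s : 0 < s -> 1 < q -> snull s q (bounded_by M lam).
Proof.
move=> s0 q1; have q0 : 0 < q by lra.
have Q1 : 1 < q `^ s.
  have -> : (1 : R) = 1 `^ s by rewrite powR1.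
  by apply: gt0_ltr_powR; rewrite ?nnegrE ?ltW.
have nF0 : snull s q (following_lam 1).
  (* A high enough level m is null directly; descending to level 0 leaves only the first digit of
     lambda prescribed. *)
  have [m Hm] := expr_unbounded 2 Q1.
  have : snull s q (following_lam (2 ^ m)).
    apply: snull_following_lam => //; apply: lt_le_trans Hm _.
    by rewrite ler_weXn2l ?(ltW Q1)// ltnW// ltn_expl.
  by elim: m {Hm} => // m IH /(snull_bounded_step s0 q1).
apply: snull_sub (snullU s0 (snull1 q (fun=> M./2) s0) (@snull_eventually _ M _ _ _ s0 q1
   (snullU s0 nF0 (snull_reflect s0 q1 (@following_lam_digit _) nF0)))) => x Vx.
have dx : digit_seq M x by case: Vx.
(* Since lambda_1 is [M./2 + 1], a digit strictly between M - lambda_1 and lambda_1 can only be M/2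
   with M even; a sequence avoiding both extremes is constant. *)
have [[k Hk]|H] := pselect (exists k, x k = lam 0%N \/ (M - x k)%N = lam 0%N).
  right; split => //; exists k; have Vk := bounded_by_shift k Vx; case: Hk => Hk; [left|right].
    by split => // -[|//] _; rewrite /shift addn0.
  exists (reflect_seq M (shift k x)); last by rewrite reflectK//; exact: digit_shift.
  split; first exact: bounded_by_reflect.
  by move=> -[|//] _; rewrite /reflect_seq /shift addn0.
left; apply/funext => k.
have [lo hi] : lex_le (reflect_seq M lam) (shift k x) /\ lex_le (shift k x) lam by case: Vx => _; exact.
have := @lex_le_digit 0 _ _ lo; have := @lex_le_digit 0 _ _ hi.
rewrite /reflect_seq /shift addn0 => /(_ (fun i H => match notF H with end)) h1.
move=> /(_ (fun i H => match notF H with end)) h2.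
have h3 : x k <> lam 0%N by move=> e; apply: H; exists k; left.
have h4 : (M - x k)%N <> lam 0%N by move=> e; apply: H; exists k; right.
move: h1 h2 h3 h4; rewrite /lam lamKL0; have := dx k.
by have := odd_double_half M; case: odd; rewrite -addnn; lia.
Qed.

End KomornikLoreti.

(** * From null sets to equal dimensions, and the ranges of q *)

Lemma eq_dimH (R : realType) (A B : set R) : A `<=` B ->
  (forall s, 0 < s -> null s A -> null s B) -> dimH A = dimH B.
Proof.
move=> AB H; rewrite /dimH; congr ereal_inf; congr image.
apply/seteqP; split => s [s0 hs]; split => //; move: s0; rewrite le_eqVlt => /orP[/eqP E|s0].
- by move: hs; rewrite -E => /hmeas0_neq0.
- exact/null_hmeas/H/hmeas_null.
- by move: hs; rewrite -E => /hmeas0_neq0.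
- by apply/null_hmeas/(null_sub AB)/hmeas_null.
Qed.

Lemma snull_local_top (R : realType) (M : nat) (s r d : R) : (0 < M)%N -> 0 < s -> 0 < d ->
  Uq M M.+1%:R r -> null s (Uq M M.+1%:R `&` `]r - d, r + d[) ->
  snull s M.+1%:R (bounded_by M (fun=> M)).
Proof.
move=> M0 s0 d0 Ur nU; have hq := top_base R M0; have ha := alpha_top R M0.
have [x [dx rx ux]] := Uq_elim hq Ur.
have [n Hn] := qval_near hq dx d0.
have dV : bounded_by M (fun=> M) `<=` digit_seq M by move=> c [].
apply: (@snull_of_local R M M.+1%:R (fun=> M) hq s r d x n _ s0 dx dV nU) => c /dV dc.
set y := wcat _ _ => nen.
have dy : digit_seq M y by exact: digit_wcat.
have Vy : bounded_by M (fun=> M) y by rewrite -(Vq_bounded_by ha); exact: Vq_top.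
split; last by rewrite rx; apply: (Hn n) => //; exact: wcat_mkseq_agree.
by split => i _; have [] := bounded_tail_lt1 hq ha i.+1 Vy nen.
Qed.

Theorem theorem3p1 (R : realType) (M : nat) (qKL q : R) :
  (0 < M)%N ->
  1 < qKL <= M.+1%:R -> is_alpha M qKL (lamKL M) ->
  (1 < q <= qKL \/
   (qKL < q <= M.+1%:R /\
    forall pL pR : R, is_plateau M qKL pL pR -> ~ (pL < q <= pR))) ->
  forall x delta : R, Uq M q x -> 0 < delta ->
  dimH (Uq M q `&` `]x - delta, x + delta[) = dimH (Uq M q).
Proof.
move=> M0 /andP[qKL1 qKLM] hKL hq x d Ux d0.
have hq1 : 1 < q <= M.+1%:R by case: hq => [|[]] /andP[h1 h2]; lra.
have [a ha] := alpha_exists hq1; have /andP[q1 qM] := hq1.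
apply: eq_dimH => [r []//|s s0 nU].
apply: (snull_univoque hq1 ha s0).
case: hq => [/andP[_ qKLq]|[qKLq noplateau]].
  have dlam := alpha_digit hKL.
  apply: snull_sub (snull_bounded_by_lam M0 dlam s0 q1).
  apply: bounded_by_mono => //; move: qKLq; rewrite le_eqVlt => /orP[/eqP E|lt].
    by rewrite E in ha; rewrite (alpha_unique ha hKL); exact: lex_le_refl.
  by apply/lex_ltW/(alpha_lt q1 _ ha hKL); rewrite lt.
move: qM; rewrite le_eqVlt => /orP[/eqP E|qM].
  subst q; rewrite (alpha_unique ha (alpha_top R M0)).
  exact: snull_local_top Ux nU.
have hq2 : 1 < q < M.+1%:R by rewrite q1.
exact: (snull_local hq2 ha (Hent_lt_left M0 qKL1 qKLq noplateau) s0 d0 Ux nU).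
Qed.
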